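(* For topologically transitive maps in the class $\mathcal{CPMM}$, the existence of a nonnegative eigenvector of the transition matrix with eigenvalue $\lambda$ is necessary but not sufficient for conjugacy to a map of constant slope $\lambda$. That is: (a) (Necessity) Let $f\in\mathcal{CPMM}$ be topologically transitive, with partition set $P$ and transition matrix $T=T(f,P)$, and let $\lambda>1$. If $f$ is conjugate via a homeomorphism $\psi$ to some map $g\in\mathcal{CPMM}$ of constant slope $\lambda$, then $T$ has a nonnegative eigenvector $v=(v_I)\in\mathbb{R}^{\mathcal{B}(P)}$ with eigenvalue $\lambda$. (b) (Non-sufficiency) There exist a topologically transitive map $f\in\mathcal{CPMM}$ with a partition set $P$ and a number $\lambda>1$ such that the transition matrix $T(f,P)$ has a nonnegative eigenvector $v\in\mathbb{R}^{\mathcal{B}(P)}$ with eigenvalue $\lambda$, but $f$ is not conjugate via any homeomorphism to any map $g\in\mathcal{CPMM}$ of constant slope $\lambda$.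
   Context: The extended real line $[-\infty,\infty]=\mathbb{R}\cup\{-\infty,\infty\}$ carries the order topology. Class $\mathcal{CPMM}$: a continuous map $f:[a,b]\to[a,b]$, where $-\infty\le a<b\le\infty$ (the interval depends on $f$ and may have infinite length), belongs to $\mathcal{CPMM}$ (countably piecewise monotone and Markov) with partition set $P$ if $P\subset[a,b]$ is a closed countable set with $a,b\in P$, $f(P)\subset P$, and $f$ is monotone on each connected component of $[a,b]\setminus P$. The components of $[a,b]\setminus P$ are called $P$-basic intervals, and $\mathcal{B}(P)$ is the set of all $P$-basic intervals. Constant slope: a map in $\mathcal{CPMM}$ with partition set $P$ has constant slope $\lambda$ if its restriction to each $P$-basic interval is affine with slope of absolute value $\lambda$. (For $g$, this is with respect to a partition set of $g$.) Transition matrix: $T=T(f,P)$ has rows and columns indexed by $\mathcal{B}(P)$, with $T(I,J)=1$ if $f(I)\supseteq J$ and $T(I,J)=0$ otherwise. A nonnegative eigenvector of $T$ with eigenvalue $\lambda$ is a nonzero $v=(v_I)_{I\in\mathcal{B}(P)}$ with real entries $v_I\ge 0$ such that $\sum_{J\in\mathcal{B}(P)}T(I,J)v_J=\lambda v_I$ (in particular the sum converges) for every $I\in\mathcal{B}(P)$. Conjugate via $\psi$: $f:[a,b]\to[a,b]$ is conjugate to $g:[c,d]\to[c,d]$ via $\psi$ if $\psi:[a,b]\to[c,d]$ is a homeomorphism with $\psi\circ f=g\circ\psi$; here $[c,d]$ may be any interval with $-\infty\le c<d\le\infty$. Topologically transitive: for every pair of nonempty open sets $U,V$ there exists $n_0\in\mathbb{N}$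 such that $f^{n_0}(U)\cap V\neq\emptyset$. *)

(* Defs.v *)
From HB Require Import structures.
From mathcomp Require Import all_boot all_order all_algebra.
From mathcomp Require Import all_classical all_reals all_analysis.

Set Implicit Arguments.
Unset Strict Implicit.
Unset Printing Implicit Defensive.
Import Order.TTheory GRing.Theory Num.Theory.
Import numFieldNormedType.Exports.

Local Open Scope classical_set_scope.
Local Open Scope ring_scope.

(* A map [a, b] -> [c, d] is represented by a total function \bar R -> \bar R
   of which only the restriction to [a, b] matters. *)

Section CPMM.
Context {R : realType}.
Implicit Types (a b c d : \bar R) (f g psi : \bar R -> \bar R).
Implicit Types (P : set (\bar R)) (lambda : R).

Definition basic_intervals a b P : set (set (\bar R)) :=
  [set I | exists2 x, (`[a, b] `\` P) x
                    & I = connected_component (`[a, b] `\` P) x].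

Definition monotone_on (I : set (\bar R)) f : Prop :=
  (forall x y, I x -> I y -> (x <= y)%E -> (f x <= f y)%E) \/
  (forall x y, I x -> I y -> (x <= y)%E -> (f y <= f x)%E).

Record cpmm a b f P : Prop := Cpmm {
  cpmm_lt : (a < b)%E;
  cpmm_fun : set_fun `[a, b] `[a, b] f;
  cpmm_continuous : {within `[a, b], continuous f};
  cpmm_sub : P `<=` `[a, b];
  cpmm_closed : closed P;
  cpmm_countable : countable P;
  cpmm_left : P a;
  cpmm_right : P b;
  cpmm_markov : f @` P `<=` P;
  cpmm_monotone : forall I, basic_intervals a b P I -> monotone_on I f
}.

(* When a and b belong to P, the basic intervals contain only finite points. *)
Definition constant_slope a b f P lambda : Prop :=
  forall I, basic_intervals a b P I ->
    exists s t : R, `|s| = lambda /\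
      forall x : R, I x%:E -> f x%:E = (s * x + t)%:E.

Definition cpmm_constant_slope a b f lambda : Prop :=
  exists2 P, cpmm a b f P & constant_slope a b f P lambda.

Definition transition_matrix a b f P (I J : basic_intervals a b P) : R :=
  (`[< set_val J `<=` f @` set_val I >])%:R.

(* The terms of the sum are nonnegative, so that equality of \esum with a
   finite value encodes convergence of the series. *)
Definition nonneg_eigenvector a b f P lambda
    (v : basic_intervals a b P -> R) : Prop :=
  [/\ exists I, v I != 0,
      forall I, 0 <= v I
    & forall I, \esum_(J in [set: basic_intervals a b P])
        (transition_matrix f I J * v J)%:E = (lambda * v I)%:E].

Definition homeomorphism_on a b c d psi : Prop :=
  exists phi : \bar R -> \bar R,
    [/\ set_fun `[a, b] `[c, d] psi /\ set_fun `[c, d] `[a, b] phi,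
        forall x, x \in `[a, b] -> phi (psi x) = x,
        forall y, y \in `[c, d] -> psi (phi y) = y,
        {within `[a, b], continuous psi}
      & {within `[c, d], continuous phi}].

Definition conjugate_via a b f c d g psi : Prop :=
  homeomorphism_on a b c d psi /\
  forall x, x \in `[a, b] -> psi (f x) = g (psi x).

(* U `&` `[a, b] with U open ranges over the relatively open subsets. *)
Definition topologically_transitive a b f : Prop :=
  forall U V : set (\bar R), open U -> open V ->
    U `&` `[a, b] !=set0 -> V `&` `[a, b] !=set0 ->
    exists n : nat, (iter n f @` (U `&` `[a, b])) `&` (V `&` `[a, b]) !=set0.

End CPMM.

(* Main.v *)
(** For a conjugacy [psi] of [f] to a map [g] of constant slope [lambda], the
    eigenvector is [v_I] = length of [psi(I)]: [f] is injective on each basic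
    interval, [f(I)] is, up to a countable set, a disjoint union of basic
    intervals, and [g] scales lengths by [lambda].  Lengths are finite by
    transitivity: the basic intervals of finite length and the points of [P] form
    an invariant set, and if all lengths were infinite then [g] would be affine of
    slope [+-lambda] on at most two pieces and would push points off to infinity.

    For the counterexample, start from a zigzag map of [0, oo[ which is Markov for
    the integers, expanding, and whose only [lambda = 5] eigenvectors do not tend to
    0 at infinity.  Two copies of it, exchanged by the map, are glued at infinity
    into [-1, 1], so that infinity becomes the interior point 0.  A conjugacy to a
    map of constant slope sends 0 to a finite point, and then the lengths of the
    basic intervals near 0 must tend to 0. *)

Require Import Defs.
From HB Require Import structures.
From mathcomp Require Import all_boot all_order all_algebra.
From mathcomp Require Import all_classical all_reals all_analysis.
From mathcomp Require Import measurable_realfun.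
From mathcomp Require Import ring lra zify.

Set Implicit Arguments.
Unset Strict Implicit.
Unset Printing Implicit Defensive.
Import Order.TTheory GRing.Theory Num.Theory.
Import numFieldNormedType.Exports.

Local Open Scope classical_set_scope.
Local Open Scope ring_scope.

(** * Order-convex sets and gaps of a closed set in the extended line *)

Section order_convex.
Context {R : realType}.
Implicit Types (E C : set (\bar R)) (x y z : \bar R).

(** The set [Q] along which [g] has constant slope bears no relation to psi(P), so [g] need not be
    affine on psi(I) for a [P]-basic interval [I]: lengths are compared after cutting psi(I) along
    [Q]. This requires [g] to be injective on psi(I), which weak monotonicity of [f] does not give;
    it comes from the nonzero slope. Since [psi] may reverse the order, order-convex sets replace
    any monotonicity of [psi]. Countable sets have length 0, so points of [P] and [Q] can be
    discarded.

    In the zigzag, odd integers go up by 3 and even ones down by 2. The block [2k, 2k+2] of two unit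
    intervals then covers the block below it once, itself twice and the block above it twice, so
    block sums of an eigenvector satisfy lambda c_k = c_(k-1) + 2 c_k + 2 c_(k+1). At lambda = 5 = 1
    + 2 + 2 the characteristic roots are 1 and 1/2, and the equation at the origin excludes the
    purely decaying solution. The two copies are exchanged because otherwise each half of [-1, 1]
    would be invariant and the glued map would not be transitive. *)

Definition order_convex E : Prop :=
  forall x y, E x -> E y -> forall z, (x <= z <= y)%E -> E z.

Lemma connected_order_convex E : connected E -> order_convex E.
Proof.
move=> cE x y Ex Ey z /andP[xz zy]; apply: contrapT => nEz.
have neqz w : E w -> w != z by move=> Ew; apply/eqP => wz; apply: nEz; rewrite -wz.
have EB : E `&` [set w | (w < z)%E] = E.
  apply: cE; first by exists x; split=> //=; rewrite lt_neqAle neqz.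
  - by exists [set w | (w < z)%E]; [exact: open_ereal_lt_ereal|].
  - exists [set w | (w <= z)%E]; first exact: closed_ereal_ge_ereal.
    rewrite eqEsubset; split=> w /= [Ew wz]; split=> //; first exact: ltW.
    by rewrite lt_neqAle neqz.
by have := Ey; rewrite -EB => -[_] /=; rewrite ltNge zy.
Qed.

(** [contract] after [expand] clamps a real number to [-1, 1], which does not increase distances,
    and the balls of the extended line are measured through [contract]. *)
Lemma expand_continuous : continuous (@expand R).
Proof.
have clamp (u : R) : [\/ 1 <= u /\ contract (expand u) = 1,
    u <= -1 /\ contract (expand u) = -1 |
    [/\ -1 <= u, u <= 1 & contract (expand u) = u]].
  have [u1|u1] := leP 1 u; first by apply: Or31; rewrite expand1.
  have [u2|u2] := leP u (-1); first by apply: Or32; rewrite expandN1.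
  by apply: Or33; split; rewrite ?ltW// expandK// inE/= ler_norml !ltW.
have h (r : R) : expand u @[u --> r] --> expand r.
  apply/cvg_ballP => e e0; near=> u.
  rewrite /ball /= /ereal_ball; have : `|r - u| < e.
    by near: u; apply: (@nbhsx_ballx _ R^o r e).
  apply: le_lt_trans; have := ler_norm (r - u); have := ler_norm (u - r).
  rewrite distrC; have := normr_ge0 (r - u); set A := `|r - u| => A0 ur ru.
  by rewrite ler_norml; case: (clamp r) => [[r1 ->]|[r1 ->]|[r1 r2 ->]];
    case: (clamp u) => [[u1 ->]|[u1 ->]|[u1 u2 ->]]; apply/andP; split; lra.
by move=> r; exact: h.
Unshelve. all: by end_near. Qed.

(** On the real line connected sets are the intervals; [contract] carries [E] there and the
    continuous map [expand] carries it back. *)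
Lemma order_convex_connected E : order_convex E -> connected E.
Proof.
move=> cE; have -> : E = @expand R @` (@contract R @` E).
  by rewrite image_comp -[LHS]image_id; apply: eq_imagel => x _ /=; rewrite contractK.
apply: connected_continuous_connected; last first.
  by apply: continuous_subspaceT; exact: expand_continuous.
apply/connected_intervalP => _ _ [x Ex <-] [y Ey <-] t /andP[xt ty].
have t1 : `|t| <= 1.
  rewrite ler_norml; have := contract_le1 x; have := contract_le1 y.
  by rewrite !ler_norml; lra.
exists (expand t); last by rewrite expandK.
apply: (cE _ _ Ex Ey); rewrite -[X in (X <= _ <= _)%E]contractK.
by rewrite -[X in (_ <= _ <= X)%E]contractK !le_expand.
Qed.

Lemma order_convex_itv (i : interval (\bar R)) : order_convex [set` i].
Proof.
case: i => l r x y /=; rewrite !itv_boundlr => /andP[lx _] /andP[_ yr] z /andP[xz zy].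
by rewrite itv_boundlr (le_trans lx) ?bnd_simp// (le_trans _ yr)// bnd_simp.
Qed.

Lemma order_convexI E C : order_convex E -> order_convex C -> order_convex (E `&` C).
Proof.
move=> cE cC x y [Ex Cx] [Ey Cy] z xzy.
by split; [exact: (cE x y)|exact: (cC x y)].
Qed.

Lemma order_convex_is_interval E :
  order_convex E -> is_interval (EFin @^-1` E : set R).
Proof. by move=> cE x y Ex Ey z xzy; apply: (cE _ _ Ex Ey); rewrite !lee_fin. Qed.

Lemma order_convex_image (D E : set (\bar R)) (f : \bar R -> \bar R) :
  {within D, continuous f} -> E `<=` D -> order_convex E -> order_convex (f @` E).
Proof.
move=> cf ED cE; apply: connected_order_convex.
apply: connected_continuous_connected; first exact: order_convex_connected.
exact: continuous_subspaceW cf.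
Qed.

End order_convex.

Section gaps.
Context {R : realType}.
Implicit Types (a b p q x y z : \bar R) (P I J : set (\bar R)).

Definition gap P p q : Prop :=
  [/\ P p, P q, (p < q)%E & forall z, (p < z < q)%E -> ~ P z].

Lemma ereal_between p q : (p < q)%E -> exists r : R, (p < r%:E < q)%E.
Proof.
case: p q => [p||] [q||] //.
- by rewrite lte_fin => pq; exists ((p + q) / 2); rewrite !lte_fin; lra.
- by move=> _; exists (p + 1); rewrite lte_fin ltry ltrDl ltr01.
- by move=> _; exists (q - 1); rewrite lte_fin ltNyr ltrBlDr ltrDl ltr01.
- by move=> _; exists 0; rewrite ltNyr ltry.
Qed.

Lemma gap_component a b P p q x : P `<=` `[a, b] -> gap P p q ->
  (p < x < q)%E -> connected_component (`[a, b] `\` P) x = `]p, q[%classic.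
Proof.
move=> Pab [Pp Pq pq nP] xpq; have nPx := nP _ xpq; move: (xpq) => /andP[px xq].
have := Pab _ Pp; have := Pab _ Pq; rewrite /= !in_itv/= => /andP[_ qb] /andP[ap _].
rewrite eqEsubset; split; last first.
  apply: connected_component_max => [|y /=|]; first by rewrite /= in_itv.
  - rewrite !in_itv/= => ypq; split; last exact: nP.
    by case/andP: ypq => py yq; rewrite (le_trans ap (ltW py)) (le_trans (ltW yq)).
  - by apply: order_convex_connected; exact: order_convex_itv.
have cC := connected_order_convex (@component_connected _ (`[a, b] `\` P) x).
have sC := @connected_component_sub _ (`[a, b] `\` P) x.
have xx : connected_component (`[a, b] `\` P) x x.
  apply: connected_component_refl; split => //=.
  by rewrite in_itv/= (le_trans ap (ltW px)) (le_trans (ltW xq)).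
move=> y Cy; rewrite /= in_itv/=; apply/andP; split; rewrite ltNge; apply/negP => h.
- by have [] := sC p (cC _ _ Cy xx p _); rewrite // h ltW.
- by have [] := sC q (cC _ _ xx Cy q _); rewrite // h andbT ltW.
Qed.

(** Since [P] is closed, the supremum of its points below [x] and the infimum of its points above
    [x] belong to it; [a] and [b] make both sets nonempty. *)
Lemma gap_exists a b P x : closed P -> P `<=` `[a, b] -> P a -> P b ->
  (a <= x <= b)%E -> ~ P x -> exists p q, gap P p q /\ (p < x < q)%E.
Proof.
move=> cP Pab Pa Pb /andP[ax xb] nPx.
have cL : closed (P `&` [set y | (y <= x)%E]).
  by apply: closedI => //; exact: closed_ereal_ge_ereal.
have cU : closed (P `&` [set y | (x <= y)%E]).
  by apply: closedI => //; exact: closed_ereal_le_ereal.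
have L0 : P `&` [set y | (y <= x)%E] !=set0 by exists a.
have U0 : P `&` [set y | (x <= y)%E] !=set0 by exists b.
have : (P `&` [set y | (y <= x)%E]) (ereal_sup (P `&` [set y | (y <= x)%E])).
  by apply: (itv_closed_supremums L0 cL); split=> [y|y] yL;
    [exact: ereal_sup_ubound|apply: ge_ereal_sup => z; exact: yL].
set p := ereal_sup _ => -[Pp px].
have : (P `&` [set y | (x <= y)%E]) (ereal_inf (P `&` [set y | (x <= y)%E])).
  by apply: (itv_closed_infimums U0 cU); split=> [y|y] yU;
    [exact: ereal_inf_lbound|apply: le_ereal_inf_tmp => z; exact: yU].
set q := ereal_inf _ => -[Pq xq].
have neqx y : P y -> y != x by move=> Py; apply/eqP => yx; apply: nPx; rewrite -yx.
have px' : (p < x)%E by rewrite lt_neqAle neqx.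
have xq' : (x < q)%E by rewrite lt_neqAle eq_sym neqx.
exists p, q; split; last by rewrite px'.
split => //; first exact: lt_trans xq'.
move=> z /andP[pz zq] Pz; case: (leP z x) => zx.
- by move: pz; rewrite ltNge => /negP; apply; apply: ereal_sup_ubound.
- by move: zq; rewrite ltNge => /negP; apply; apply: ereal_inf_lbound; split=> //; exact: ltW.
Qed.

Lemma basic_intervalsP a b P I : closed P -> P `<=` `[a, b] -> P a -> P b ->
  basic_intervals a b P I <->
  exists p q, gap P p q /\ I = `]p, q[%classic.
Proof.
move=> cP Pab Pa Pb; split.
- move=> [x [/= xab nPx] ->]; move: (xab); rewrite in_itv/= => axb.
  have [p [q [gpq xpq]]] := gap_exists cP Pab Pa Pb axb nPx.
  by exists p, q; split=> //; exact: gap_component xpq.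
- move=> [p [q [gpq ->]]]; have [Pp Pq pq nP] := gpq.
  have [x xpq] : exists x, (p < x < q)%E by have [r] := ereal_between pq; exists r%:E.
  exists x; last by rewrite (gap_component Pab gpq xpq).
  split; last exact: nP.
  have /= := Pab _ Pp; have /= := Pab _ Pq; rewrite !in_itv/= => /andP[_ qb] /andP[ap _].
  by case/andP: xpq => px xq; rewrite (le_trans ap (ltW px)) (le_trans (ltW xq)).
Qed.

End gaps.

(** * Length of the finite part of a set *)

Section real_length.
Context {R : realType}.
Implicit Types (E C : set (\bar R)).

Local Notation leb := (@lebesgue_measure R).

(** Dropping the two infinite points reduces lengths in the extended line to Lebesgue measure on the
    real line. *)
Definition real_length E : \bar R := leb (EFin @^-1` E).

Lemma real_length_ge0 E : (0 <= real_length E)%E.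
Proof. exact: measure_ge0. Qed.

Lemma measurable_order_convex E : order_convex E ->
  measurable (EFin @^-1` E : set (measurableTypeR R)).
Proof. by move=> cE; apply: is_interval_measurable; exact: order_convex_is_interval. Qed.

Lemma countable_real_part C : countable C -> countable (EFin @^-1` C : set R).
Proof.
move=> /countable_injP[h hinj]; apply/countable_injP; exists (h \o EFin).
move=> x y /[!inE] Cx Cy /= hxy.
by have [] : x%:E = y%:E by apply: hinj; rewrite ?inE.
Qed.

Lemma esum_real_length (T : choiceType) (D : set T) (A : T -> set (\bar R)) C :
  countable D -> countable C -> (forall i, D i -> order_convex (A i)) ->
  trivIset D A ->
  real_length (\bigcup_(i in D) A i `|` C) = (\esum_(i in D) real_length (A i))%E.
Proof.
move=> cD cC cA tA.
have mA i : D i -> measurable (EFin @^-1` A i : set (measurableTypeR R)).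
  by move=> Di; apply: measurable_order_convex; exact: cA.
have [h hinj] := countable_injP _ cD.
(* Countable additivity is stated for families indexed by naturals, so the sets are renumbered along
   the injection [h]; [F n] is empty when [n] is not the number of an index in [D]. *)
pose F n := \bigcup_(i in D `&` [set i | h i = n]) (EFin @^-1` A i : set (measurableTypeR R)).
have FE i : D i -> F (h i) = EFin @^-1` A i.
  move=> Di; rewrite /F (_ : _ `&` _ = [set i]) ?bigcup_set1//.
  rewrite eqEsubset; split=> [j /= [Dj hji]|j ->//].
  by apply: hinj; rewrite ?inE.
have mF n : (h @` D) n -> measurable (F n) by move=> [i Di <-]; rewrite FE//; exact: mA.
rewrite /real_length preimage_setU preimage_bigcup.
have -> : \bigcup_(i in D) (EFin @^-1` A i) = \bigcup_(n in h @` D) F n.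
  by rewrite bigcup_image; apply: eq_bigcupr => i Di; rewrite FE.
have mC := countable_measurable (fun x : measurableTypeR R => measurable_set1 x)
  (countable_real_part cC).
rewrite measureU0//; last 2 first.
- exact: bigcup_measurable.
- exact: countable_lebesgue_measure0 (countable_real_part cC).
rewrite measure_bigcup//; last first.
  move=> _ _ [i Di <-] [j Dj <-]; rewrite !FE// => -[x [Aix Ajx]].
  by congr h; apply: (tA i j) => //; exists x%:E.
rewrite nneseries_esum// set_mem_set esum_image.
  by apply: eq_esum => i Di; rewrite FE.
by move=> i j Di Dj; exact: hinj.
Qed.

Lemma real_length_affine (s t : R) E : s != 0 ->
  measurable (EFin @^-1` E : set (measurableTypeR R)) ->
  leb [set s * x + t | x in EFin @^-1` E] = (`|s|%:E * real_length E)%E.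
Proof.
move=> s0 mE.
pose h : measurableTypeR R -> measurableTypeR R := fun y => (y - t) / s.
have mh : measurable_fun setT h.
  by apply: measurable_funM => //; apply: measurable_funD.
pose hm : {mfun measurableTypeR R >-> measurableTypeR R} :=
  HB.pack h (isMeasurableFun.Build _ _ _ _ h mh).
have s1 : 0 <= `|s|^-1 by rewrite invr_ge0.
have hE (X : set R) : [set s * x + t | x in X] = h @^-1` X.
  rewrite eqEsubset; split=> [_ [x Xx <-]|y Xy]; rewrite /preimage/= /h.
    by rewrite addrK mulrC mulKf.
  by exists (h y) => //; rewrite /h mulrC divfK// subrK.
rewrite hE /real_length.
(* The measure sending [A] to [|s|^-1] times the length of [s * A + t] agrees with Lebesgue measure
   on the intervals []a, b]], hence everywhere by uniqueness. A negative [s] turns []a, b]] into an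
   interval closed on the left. *)
rewrite [X in (_ * X)%E](_ : _ =
    mscale (NngNum s1) (pushforward leb hm) (EFin @^-1` E)).
  by rewrite /mscale/= /pushforward muleA -EFinM divff ?normr_eq0// mul1e.
apply: lebesgue_measure_unique => // _ [[a b] _ <-] /=.
rewrite /mscale/= /pushforward.
have [s_gt0|s_lt0] : 0 < s \/ s < 0 by case: (ltgtP s 0) s0; [right|left|].
- have -> : hm @^-1` `]a, b] = `]s * a + t, s * b + t]%classic.
    rewrite eqEsubset; split=> y; rewrite /preimage/= !in_itv/= /h.
      by rewrite ltr_pdivlMr// ler_pdivrMr// => /andP[? ?]; apply/andP; split; lra.
    by move=> /andP[? ?]; rewrite ltr_pdivlMr// ler_pdivrMr//; apply/andP; split; lra.
  rewrite !lebesgue_measure_itv/= !lte_fin ltrD2r ltr_pM2l// gtr0_norm//.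
  case: ifP => _; last by rewrite mule0.
  by rewrite -!EFinD -EFinM; congr EFin; field; rewrite gt_eqF.
- have -> : hm @^-1` `]a, b] = `[s * b + t, s * a + t[%classic.
    rewrite eqEsubset; split=> y; rewrite /preimage/= !in_itv/= /h.
      by rewrite ltr_ndivlMr// ler_ndivrMr// => /andP[? ?]; apply/andP; split; lra.
    by move=> /andP[? ?]; rewrite ltr_ndivlMr// ler_ndivrMr//; apply/andP; split; lra.
  rewrite !lebesgue_measure_itv/= !lte_fin ltrD2r ltr_nM2l// ltr0_norm//.
  case: ifP => _; last by rewrite mule0.
  by rewrite -!EFinD -EFinM; congr EFin; field; rewrite lt_eqF.
Qed.

Lemma le_real_length E C : order_convex E -> order_convex C -> E `<=` C ->
  (real_length E <= real_length C)%E.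
Proof.
by move=> cE cC EC; apply: le_measure; rewrite ?inE;
  [exact: measurable_order_convex|exact: measurable_order_convex|move=> x; exact: EC].
Qed.

Lemma real_length_itv (x y : \bar R) : (x < y)%E ->
  real_length `]x, y[ = (y - x)%E.
Proof.
case: x y => [x||] [y||]// xy; rewrite /real_length.
- rewrite (_ : EFin @^-1` _ = `]x, y[%classic).
    by rewrite lebesgue_measure_itv ifT.
  by apply/seteqP; split => z; rewrite /preimage/= !in_itv/= !lte_fin.
- rewrite (_ : EFin @^-1` _ = `]x, +oo[%classic) ?lebesgue_measure_itv ?xy//.
  by apply/seteqP; split => z; rewrite /preimage/= !in_itv/= ltry !lte_fin.
- rewrite (_ : EFin @^-1` _ = `]-oo, y[%classic) ?lebesgue_measure_itv ?xy//.
  by apply/seteqP; split => z; rewrite /preimage/= !in_itv/= ltNyr !lte_fin.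
- rewrite (_ : EFin @^-1` _ = `]-oo, +oo[%classic) ?lebesgue_measure_itv ?xy//.
  by apply/seteqP; split => z; rewrite /preimage/= !in_itv/= ltNyr ltry.
Qed.

Lemma real_lengthU_countable E C : order_convex E -> countable C ->
  real_length (E `|` C) = real_length E.
Proof.
move=> cE cC; rewrite /real_length preimage_setU measureU0//.
- exact: measurable_order_convex.
- apply: (countable_measurable (fun x : measurableTypeR R => measurable_set1 x)).
  exact: countable_real_part.
- exact: countable_lebesgue_measure0 (countable_real_part cC).
Qed.

End real_length.

(** * Basic intervals: disjointness, maximality, countability *)

Section basic_intervals_theory.
Context {R : realType} (a b : \bar R) (f : \bar R -> \bar R) (P : set (\bar R)).
Hypothesis fP : cpmm a b f P.
Implicit Types (I J : set (\bar R)) (x y z p q : \bar R).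

Lemma basic_gap I : basic_intervals a b P I ->
  exists p q, gap P p q /\ I = `]p, q[%classic.
Proof.
by case: fP => _ _ _ Pab cP _ Pa Pb _ _; move/(basic_intervalsP I cP Pab Pa Pb).
Qed.

Lemma basic_sub I : basic_intervals a b P I -> I `<=` `[a, b] `\` P.
Proof. by move=> [x _ ->]; exact: connected_component_sub. Qed.

Lemma basic_convex I : basic_intervals a b P I -> order_convex I.
Proof. by move=> /basic_gap[p [q [_ ->]]]; exact: order_convex_itv. Qed.

Lemma basic_open I : basic_intervals a b P I -> open I.
Proof. by move=> /basic_gap[p [q [_ ->]]]; exact: itv_open. Qed.

Lemma basic_ex_fin I : basic_intervals a b P I -> exists r : R, I r%:E.
Proof.
move=> /basic_gap[p [q [[_ _ pq _] ->]]]; have [r rpq] := ereal_between pq.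
by exists r; rewrite /= in_itv.
Qed.

Lemma basic_fin I x : basic_intervals a b P I -> I x -> x \is a fin_num.
Proof.
move=> /basic_gap[p [q [_ ->]]]; rewrite /= in_itv/= => /andP[px xq].
by rewrite fin_numE gt_eqF ?lt_eqF// ?(le_lt_trans _ px) ?(lt_le_trans xq)// ?leNye ?leey.
Qed.

Lemma basic_cover x : x \in `[a, b] -> ~ P x ->
  exists I, basic_intervals a b P I /\ I x.
Proof.
move=> xab nPx; exists (connected_component (`[a, b] `\` P) x); split.
  by exists x.
exact: connected_component_refl.
Qed.

Lemma basic_eq I J x : basic_intervals a b P I -> basic_intervals a b P J ->
  I x -> J x -> I = J.
Proof.
by move=> [y _ ->] [z _ ->] /same_connected_component-> /same_connected_component->.
Qed.

Lemma basic_max I (E : set (\bar R)) x : basic_intervals a b P I -> I x -> E x ->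
  order_convex E -> E `<=` `[a, b] `\` P -> E `<=` I.
Proof.
move=> [y _ ->] yx Ex cE EP; rewrite (same_connected_component yx).
by apply: connected_component_max => //; exact: order_convex_connected.
Qed.

Lemma trivIset_basic :
  trivIset [set: basic_intervals a b P]
    (fun K : basic_intervals a b P => set_val K : set (\bar R)).
Proof.
move=> K L _ _ [x [Kx Lx]]; apply: val_inj.
exact: (basic_eq (set_valP K) (set_valP L) Kx Lx).
Qed.

Lemma countable_basic : countable [set: basic_intervals a b P].
Proof.
apply: (@separated_open_countable R _
  (fun I : basic_intervals a b P => EFin @^-1` (set_val I : set (\bar R)))).
- move=> I; have [p [q [_ Ipq]]] := basic_gap (set_valP I).
  have {Ipq}-> : set_val I = `]p, q[%classic := Ipq.
  rewrite (_ : _ @^-1` _ = [set r : R | p < r%:E]%E `&` [set r : R | r%:E < q]%E).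
    by apply: openI; [exact: open_ereal_gt|exact: open_ereal_lt].
  by apply/seteqP; split=> r; rewrite /preimage/= in_itv/= => /andP.
- by move=> I; have [r] := basic_ex_fin (set_valP I); exists r.
- move=> I J _ _ [x [Ix Jx]]; apply: trivIset_basic => //.
  by exists x%:E.
Qed.

End basic_intervals_theory.

Lemma ge0_esumZl (R : realType) (T : choiceType) (D : set T) (a : T -> \bar R) (r : R) :
  (0 < r)%R -> (forall i, 0 <= a i)%E ->
  (\esum_(i in D) (r%:E * a i) = r%:E * \esum_(i in D) a i)%E.
Proof.
move=> r0 a0; rewrite /esum -ereal_sup_pZl// image_comp; congr ereal_sup.
by apply: eq_imagel => A _ /=; rewrite ge0_mule_fsumr.
Qed.

(** The set [E] may cross many points of [Q]: it is cut along the [Q]-basic intervals, each piece is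
    scaled by [lambda], and injectivity keeps the images disjoint so that their lengths add up. *)
Lemma constant_slope_real_length (R : realType) (c d : \bar R) (g : \bar R -> \bar R)
    (Q : set (\bar R)) (lambda : R) (E : set (\bar R)) :
  cpmm c d g Q -> constant_slope c d g Q lambda -> 0 < lambda ->
  order_convex E -> E `<=` `[c, d] ->
  (forall x y, E x -> E y -> g x = g y -> x = y) ->
  real_length (g @` E) = (lambda%:E * real_length E)%E.
Proof.
move=> gQ sg l0 cE Ecd ginj; have [_ _ gcont _ _ cQ _ _ _ _] := gQ.
pose A (K : basic_intervals c d Q) := E `&` (set_val K : set (\bar R)).
have cA K : order_convex (A K).
  by apply: order_convexI => //; exact: (basic_convex gQ) (set_valP K).
have EA : E = \bigcup_(K in setT) A K `|` (E `&` Q).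
  apply/seteqP; split=> [x Ex|x [[K _ [Ex Kx]]//|[]//]].
  have [Qx|nQx] := pselect (Q x); first by right.
  have [K [bK Kx]] := basic_cover (Ecd _ Ex) nQx; left.
  by exists (SigSub (mem_set bK)).
have tA : trivIset setT A.
  by move=> K L _ _ [x [[_ Kx] [_ Lx]]]; apply: trivIset_basic => //; exists x.
have gE : g @` E = \bigcup_(K in setT) (g @` A K) `|` (g @` (E `&` Q)).
  by rewrite [in LHS]EA image_setU image_bigcup.
have cEQ : countable (E `&` Q) by apply: sub_countable cQ; exact: subset_card_le.
rewrite gE [in RHS]EA !esum_real_length//.
- rewrite -ge0_esumZl //.
  apply: eq_esum => K _; have [s [t [sl gst]]] := sg _ (set_valP K).
  have s0 : s != 0.
    by rewrite -normr_eq0; apply/negP => /eqP s0; move: l0; rewrite -sl s0 ltxx.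
  have -> : real_length (g @` A K) =
      (@lebesgue_measure R) [set s * x + t | x in EFin @^-1` A K].
    congr (@lebesgue_measure R _); apply/seteqP; split=> y; rewrite /preimage/=.
      move=> [x Ax gxy]; have xfin := basic_fin gQ (set_valP K) (proj2 Ax).
      exists (fine x); first by rewrite fineK.
      by apply: EFin_inj; rewrite -gst ?fineK//; case: Ax.
    by move=> [x Ax <-]; exists x%:E => //; rewrite gst//; case: Ax.
  by rewrite -sl real_length_affine//; exact: measurable_order_convex.
- exact: countable_basic gQ.
- exact: countable_basic gQ.
- by apply: sub_countable cEQ; exact: card_image_le.
- move=> K _; apply: (order_convex_image gcont) => //.
  by move=> x [Ex _]; exact: Ecd.
- move=> K L _ _ [_ [[x [Ex Kx] <-] [y [Ey Ly] gyx]]].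
  apply: trivIset_basic => //; exists x; split => //.
  by rewrite -(ginj _ _ Ey Ex gyx).
Qed.

(** * Conjugacies to maps of constant slope *)

(** Otherwise an interval with two distinct finite endpoints would be countable, hence of length
    0. *)
Lemma countable_avoid (R : realType) (u w : \bar R) (C : set (\bar R)) :
  countable C -> (u < w)%E -> exists r : R, (u < r%:E < w)%E /\ ~ C r%:E.
Proof.
move=> cC uw; have [r /andP[ur rw]] := ereal_between uw.
have [s /andP[rs sw]] := ereal_between rw.
apply: contrapT => /forallNP nC.
have : real_length `]r%:E, s%:E[ = 0%E.
  apply: countable_lebesgue_measure0; apply: countable_real_part.
  apply: sub_countable cC; apply: subset_card_le => x; rewrite /= in_itv/=.
  move=> /andP[rx xs]; apply: contrapT => nCx; apply: (nC (fine x)).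
  have xfin : x \is a fin_num.
    by rewrite fin_numE gt_eqF ?lt_eqF// ?(lt_trans _ rx) ?(lt_trans xs)// ?ltNyr ?ltry.
  by rewrite fineK// (lt_trans ur rx) (lt_trans xs sw).
rewrite lte_fin in rs; rewrite real_length_itv ?lte_fin// => -[] /eqP.
by rewrite subr_eq0 gt_eqF.
Qed.

Section conjugacy.
Context {R : realType} (a b : \bar R) (f : \bar R -> \bar R) (P : set (\bar R)).
Context (c d : \bar R) (g : \bar R -> \bar R) (Q : set (\bar R)) (lambda : R).
Context (psi phi : \bar R -> \bar R).
Hypotheses (fP : cpmm a b f P) (gQ : cpmm c d g Q).
Hypotheses (sg : constant_slope c d g Q lambda) (lambda1 : 1 < lambda).
Hypotheses (psi_fun : set_fun `[a, b] `[c, d] psi) (phi_fun : set_fun `[c, d] `[a, b] phi).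
Hypotheses (psiK : forall x, x \in `[a, b] -> phi (psi x) = x)
  (phiK : forall y, y \in `[c, d] -> psi (phi y) = y).
Hypotheses (psi_cont : {within `[a, b], continuous psi})
  (phi_cont : {within `[c, d], continuous phi}).
Hypothesis fg : forall x, x \in `[a, b] -> psi (f x) = g (psi x).
Implicit Types (I J E : set (\bar R)) (x y z p q u w : \bar R).

Let f_fun x : x \in `[a, b] -> f x \in `[a, b].
Proof. by case: fP => _ ff *; exact: ff. Qed.

Lemma psi_inj x y : x \in `[a, b] -> y \in `[a, b] -> psi x = psi y -> x = y.
Proof. by move=> xab yab xy; rewrite -(psiK xab) xy psiK. Qed.

Lemma order_convex_psi E : E `<=` `[a, b] -> order_convex E -> order_convex (psi @` E).
Proof. by move=> Eab cE; exact: order_convex_image psi_cont Eab cE. Qed.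

(** Some point strictly between [u] and [w] avoids the countable set [Q]; in the open [Q]-basic
    interval around it, two nearby points have distinct images because the slope is nonzero. *)
Lemma constant_slope_not_constant u w k :
  u \in `[c, d] -> w \in `[c, d] -> (u < w)%E -> ~ forall y, (u <= y <= w)%E -> g y = k.
Proof.
rewrite !in_itv/= => /andP[cu _] /andP[_ wd] uw gk.
have [_ _ _ _ _ cQ _ _ _ _] := gQ.
have [r [/andP[ur rw] nQr]] := countable_avoid cQ uw.
have rcd : r%:E \in `[c, d].
  by rewrite in_itv/= (le_trans cu (ltW ur)) (le_trans (ltW rw) wd).
have [K [bK Kr]] := basic_cover rcd nQr.
have [p [q [_ Kpq]]] := basic_gap gQ bK.
have /andP[pr rq] : (p < r%:E < q)%E by move: Kr; rewrite Kpq /= in_itv.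
have [|r' /andP[rr' ]] := @ereal_between R r%:E (Order.min q w).
  by rewrite lt_min rq rw.
rewrite lt_min => /andP[r'q r'w].
have Kr' : K r'%:E by rewrite Kpq /= in_itv/= (lt_trans pr rr').
have [s [t [sl gst]]] := sg bK.
have : g r%:E = g r'%:E by rewrite !gk// ?(ltW ur) ?(ltW rw)// (ltW (lt_trans ur rr')) ltW.
rewrite !gst// => -[] /addIr /mulfI rr.
move: rr'; rewrite rr ?ltxx//; apply/eqP => s0.
by move: lambda1; rewrite -sl s0 normr0 ltr10.
Qed.

(** Monotonicity makes [f] constant between two points with equal values, and [psi] would carry this
    to an interval on which [g] is constant. *)
Lemma basic_injective I x y : basic_intervals a b P I -> I x -> I y -> f x = f y -> x = y.
Proof.
move=> bI; wlog xy : x y / (x < y)%E.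
  move=> H Ix Iy fxy; have [xy|yx|//] := ltgtP x y; first exact: H.
  by apply/esym/H.
move=> Ix Iy fxy; exfalso.
have Iab z : I z -> z \in `[a, b] by move=> /(basic_sub bI)[].
have cI := basic_convex fP bI.
have fk z : (x <= z <= y)%E -> f z = f x.
  move=> xzy; have Iz := cI _ _ Ix Iy _ xzy; case/andP: xzy => xz zy.
  have [_ _ _ _ _ _ _ _ _ /(_ _ bI)[mf|mf]] := fP; apply/eqP; rewrite eq_le.
    by rewrite {1}fxy !mf.
  by rewrite {2}fxy !mf.
have cxy : order_convex (psi @` `[x, y]).
  apply: order_convex_psi; last exact: order_convex_itv.
  by move=> z; rewrite /= in_itv/= => xzy; apply: Iab; exact: (cI _ _ Ix Iy).
have Px : (psi @` `[x, y]) (psi x) by exists x => //=; rewrite in_itv/= lexx ltW.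
have Py : (psi @` `[x, y]) (psi y) by exists y => //=; rewrite in_itv/= lexx ltW.
have gk z : (psi @` `[x, y]) z -> g z = psi (f x).
  move=> [v]; rewrite /= in_itv/= => xvy <-; rewrite -fg ?fk//.
  by apply: Iab; exact: (cI _ _ Ix Iy).
(* The homeomorphism [psi] may reverse the order, so both cases occur. *)
have [pxy|pyx|/(psi_inj (Iab _ Ix) (Iab _ Iy)) exy] := ltgtP (psi x) (psi y).
- apply: (constant_slope_not_constant (k := psi (f x)) _ _ pxy); do ?exact/psi_fun/Iab.
  by move=> z pz; apply: gk; exact: cxy pz.
- apply: (constant_slope_not_constant (k := psi (f x)) _ _ pyx); do ?exact/psi_fun/Iab.
  by move=> z pz; apply: gk; exact: cxy pz.
- by rewrite exy ltxx in xy.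
Qed.

(** The endpoints of [I] are sent into [P], hence outside [J]. If [z] in [J] were missed, both
    endpoint values would lie on the side of [f x] away from [z], so a value close to [f x] on that
    side would be taken both before and after [x], against injectivity. *)
Lemma basic_image_sub I J : basic_intervals a b P I -> basic_intervals a b P J ->
  (f @` I) `&` J !=set0 -> J `<=` f @` I.
Proof.
move=> bI bJ [_ [[x Ix <-] Jfx]] z Jz; apply: contrapT => nfz.
have [p [q [[Pp Pq pq _] Ipq]]] := basic_gap fP bI.
have [_ _ fcont Pab _ _ _ _ fPP _] := fP.
have /andP[px xq] : (p < x < q)%E by move: Ix; rewrite Ipq /= in_itv.
have cJ := basic_convex fP bJ.
have nJ e : P e -> ~ J (f e).
  by move=> Pe /(basic_sub bJ)[_]; apply; apply: fPP; exists e.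
have xab : x \in `[a, b] by have [] := basic_sub bI Ix.
have Sc u w : (p <= u)%E -> (w <= q)%E -> order_convex (f @` `[u, w]).
  move=> pu wq; apply: (order_convex_image fcont); last exact: order_convex_itv.
  move=> v; rewrite /= !in_itv/= => /andP[uv vw].
  have := Pab _ Pp; have := Pab _ Pq; rewrite /= !in_itv/= => /andP[_ qb] /andP[ap _].
  by rewrite (le_trans ap (le_trans pu uv)) (le_trans (le_trans vw wq) qb).
have Sp : order_convex (f @` `[p, x]) by apply: Sc => //; exact: ltW.
have Sq : order_convex (f @` `[x, q]) by apply: Sc => //; exact: ltW.
have [xp xx] : (f @` `[p, x]) (f p) /\ (f @` `[p, x]) (f x).
  by split; [exists p|exists x] => //=; rewrite in_itv/= lexx ltW.
have [xq' xx'] : (f @` `[x, q]) (f q) /\ (f @` `[x, q]) (f x).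
  by split; [exists q|exists x] => //=; rewrite in_itv/= lexx ltW.
have Ip v : (f @` `[p, x]) v -> v != f p -> (exists2 u, I u /\ (u <= x)%E & f u = v).
  move=> [u]; rewrite /= in_itv/= => /andP[pu ux] fu vp; exists u => //; split=> //.
  rewrite Ipq /= in_itv/= (le_lt_trans ux xq) andbT lt_neqAle pu andbT.
  by apply: contraNneq vp => ->; rewrite fu.
have Iq v : (f @` `[x, q]) v -> v != f q -> (exists2 u, I u /\ (x <= u)%E & f u = v).
  move=> [u]; rewrite /= in_itv/= => /andP[xu uq] fu vq; exists u => //; split=> //.
  rewrite Ipq /= in_itv/= (lt_le_trans px xu)/= lt_neqAle uq andbT.
  by apply: contraNneq vq => <-; rewrite fu.
have zp : z != f p by apply/eqP => zfp; apply: (nJ _ Pp); rewrite -zfp.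
have zq : z != f q by apply/eqP => zfq; apply: (nJ _ Pq); rewrite -zfq.
have nzp : ~ (f @` `[p, x]) z by move=> /Ip/(_ zp)[u [Iu _] fu]; apply: nfz; exists u.
have nzq : ~ (f @` `[x, q]) z by move=> /Iq/(_ zq)[u [Iu _] fu]; apply: nfz; exists u.
have [k [k1 k2 kx]] : exists k, [/\ (f @` `[p, x]) k /\ k != f p,
    (f @` `[x, q]) k /\ k != f q & k != f x].
  have [zx|xz|zx] := ltgtP z (f x); last by exfalso; apply: nfz; exists x.
  (* If [f e] were on the side of [f x] where [z] lies, either it would fall between [z] and [f x],
     hence in [J], or [z] would fall between [f e] and [f x], hence be attained. *)
  - have side e S : P e -> S (f e) -> S (f x) -> order_convex S -> ~ S z -> (f x < f e)%E.
      move=> Pe Se Sx cS nSz; rewrite ltNge; apply/negP => ex.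
      have [ez|ze] := leP (f e) z; first by apply: nSz; apply: (cS _ _ Se Sx); rewrite ez ltW.
      by apply: (nJ _ Pe); apply: (cJ _ _ Jz Jfx); rewrite ex ltW.
    have fxp := side _ _ Pp xp xx Sp nzp; have fxq := side _ _ Pq xq' xx' Sq nzq.
    have [|k] := @ereal_between R (f x) (Order.min (f p) (f q)); first by rewrite lt_min fxp.
    rewrite lt_min => /and3P[xk kp kq]; exists k%:E; split; last by rewrite gt_eqF.
      by split; [apply: (Sp _ _ xx xp); rewrite !ltW|rewrite lt_eqF].
    by split; [apply: (Sq _ _ xx' xq'); rewrite !ltW|rewrite lt_eqF].
  - have side e S : P e -> S (f e) -> S (f x) -> order_convex S -> ~ S z -> (f e < f x)%E.
      move=> Pe Se Sx cS nSz; rewrite ltNge; apply/negP => ex.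
      have [ez|ze] := leP z (f e); first by apply: nSz; apply: (cS _ _ Sx Se); rewrite ez ltW.
      by apply: (nJ _ Pe); apply: (cJ _ _ Jfx Jz); rewrite ex ltW.
    have fxp := side _ _ Pp xp xx Sp nzp; have fxq := side _ _ Pq xq' xx' Sq nzq.
    have [|k] := @ereal_between R (Order.max (f p) (f q)) (f x); first by rewrite gt_max fxp.
    rewrite gt_max => /andP[/andP[pk qk] kx]; exists k%:E; split; last by rewrite lt_eqF.
      by split; [apply: (Sp _ _ xp xx); rewrite !ltW|rewrite gt_eqF].
    by split; [apply: (Sq _ _ xq' xx'); rewrite !ltW|rewrite gt_eqF].
have [u [Iu ux] fu] := Ip _ k1.1 k1.2; have [w [Iw xw] fw] := Iq _ k2.1 k2.2.
have uw : u = w by apply: (basic_injective bI) => //; rewrite fu.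
by move/eqP: kx; apply; rewrite -fu; congr f; apply/eqP; rewrite eq_le ux uw.
Qed.


(** * Lengths of images under the conjugated map *)

Let lambda0 : 0 < lambda. Proof. exact: lt_trans lambda1. Qed.

Let basic_in I x : basic_intervals a b P I -> I x -> x \in `[a, b].
Proof. by move=> bI /(basic_sub bI)[]. Qed.

Lemma psi_image_image E : E `<=` `[a, b] -> psi @` (f @` E) = g @` (psi @` E).
Proof.
by move=> Eab; rewrite !image_comp; apply: eq_imagel => x Ex /=; rewrite fg//; exact: Eab.
Qed.

Lemma g_injective_basic I u w : basic_intervals a b P I ->
  (psi @` I) u -> (psi @` I) w -> g u = g w -> u = w.
Proof.
move=> bI [x Ix <-] [y Iy <-]; rewrite -!fg ?(basic_in bI)// => fxy; congr psi.
by apply: (basic_injective bI) => //; apply: psi_inj fxy; exact/f_fun/(basic_in bI).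
Qed.

Lemma real_length_image E I : basic_intervals a b P I -> E `<=` I -> order_convex E ->
  real_length (g @` (psi @` E)) = (lambda%:E * real_length (psi @` E))%E.
Proof.
move=> bI EI cE; have Eab : E `<=` `[a, b] by move=> x /EI; exact: basic_in.
apply: (constant_slope_real_length gQ) => //; first exact: order_convex_psi.
- by move=> _ [x /Eab xab <-]; exact: psi_fun.
- move=> u w [x Ex <-] [y Ey <-] gxy.
  by apply: (g_injective_basic bI) gxy; [exists x|exists y] => //; exact: EI.
Qed.

Lemma esum_real_length_image I : basic_intervals a b P I ->
  real_length (psi @` (f @` I)) =
  (\esum_(J in [set J : basic_intervals a b P | (set_val J : set (\bar R)) `<=` f @` I])
     real_length (psi @` (set_val J : set (\bar R))))%E.
Proof.
move=> bI; have [_ _ _ Pab _ cP _ _ _ _] := fP.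
set D := [set J : basic_intervals a b P | _].
have fIab x : (f @` I) x -> x \in `[a, b] by move=> [y Iy <-]; exact/f_fun/(basic_in bI).
have fIE : f @` I = \bigcup_(J in D) (set_val J : set (\bar R)) `|` ((f @` I) `&` P).
  apply/seteqP; split=> [y fIy|y [[J DJ Jy]|[]//]]; last exact: DJ.
  have [Py|nPy] := pselect (P y); first by right.
  have [J [bJ Jy]] := basic_cover (fIab _ fIy) nPy; left.
  exists (SigSub (mem_set bJ)) => //; apply: (basic_image_sub bI bJ).
  by exists y.
rewrite {1}fIE image_setU image_bigcup esum_real_length//.
- by apply: sub_countable (countable_basic fP); exact: subset_card_le.
- apply: (card_le_trans (card_image_le _ _)).
  by apply: card_le_trans cP; exact: subset_card_le.
- move=> J _; apply: order_convex_psi; last exact: (basic_convex fP (set_valP J)).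
  by move=> x; exact: basic_in (set_valP J).
- move=> J K _ _ [_ [[x Jx <-] [y Ky pyx]]]; apply: trivIset_basic => //.
  exists x; split=> //; rewrite -(psi_inj _ _ pyx)//.
    exact: basic_in (set_valP K) Ky.
  exact: basic_in (set_valP J) Jx.
Qed.

Lemma real_length_basic_gt0 I : basic_intervals a b P I -> (0 < real_length (psi @` I))%E.
Proof.
move=> bI; have [p [q [[_ _ pq _] Ipq]]] := basic_gap fP bI.
have Iab x : I x -> x \in `[a, b] by exact: basic_in.
have [x /andP[px xq]] := ereal_between pq.
have [y /andP[xy yq]] := ereal_between xq.
have Ix : I x%:E by rewrite Ipq /= in_itv/= px.
have Iy : I y%:E by rewrite Ipq /= in_itv/= yq (lt_trans px).
have cpI : order_convex (psi @` I) by apply: order_convex_psi Iab _; exact: (basic_convex fP bI).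
have gt0 u w : (psi @` I) u -> (psi @` I) w -> (u < w)%E -> (0 < real_length (psi @` I))%E.
  move=> Iu Iw uw; apply: (@lt_le_trans _ _ (real_length `]u, w[)).
    by rewrite real_length_itv// sube_gt0.
  apply: le_real_length => //; first exact: order_convex_itv.
  by move=> z; rewrite /= in_itv/= => /andP[uz zw]; apply: (cpI _ _ Iu Iw); rewrite !ltW.
have [uw|wu|/(psi_inj (Iab _ Ix) (Iab _ Iy)) exy] := ltgtP (psi x%:E) (psi y%:E).
- by apply: gt0 uw; [exists x%:E|exists y%:E].
- by apply: gt0 wu; [exists y%:E|exists x%:E].
- by rewrite exy ltxx in xy.
Qed.

(* The two inclusions ]g u, g w[ c g(]u, w[) c [g u, g w] (up to order) turn the
   scaling of lengths into a scaling of distances. *)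
Lemma scaling_off_partition (u w : R) :
  u%:E \in `[c, d] -> w%:E \in `[c, d] -> u < w ->
  (forall z, (u%:E < z < w%:E)%E -> ~ (psi @` P) z) ->
  exists s t : R, [/\ g u%:E = s%:E, g w%:E = t%:E & `|s - t| = lambda * (w - u)].
Proof.
move=> ucd wcd uw nP.
have [_ _ gcont _ _ _ _ _ _ _] := gQ.
have uwcd z : (u%:E <= z <= w%:E)%E -> z \in `[c, d].
  by move=> uzw; apply: (@order_convex_itv _ `[c, d] _ _ ucd wcd).
(* As the open interval avoids psi(P), its preimage [F] is connected off [P] and lies in a single
   [P]-basic interval, where the scaling of lengths applies. *)
pose F := phi @` `]u%:E, w%:E[.
have uw_sub : `]u%:E, w%:E[ `<=` `[c, d].
  by move=> z; rewrite /= in_itv/= => /andP[uz zw]; apply: uwcd; rewrite !ltW.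
have cF : order_convex F.
  by apply: (order_convex_image phi_cont) => //; exact: order_convex_itv.
have FP : F `<=` `[a, b] `\` P.
  move=> _ [z uzw <-]; have zcd := uw_sub _ uzw; split; first exact: phi_fun.
  move=> Pz; have := nP z; rewrite /= in_itv/= in uzw; move/(_ uzw); apply.
  by exists (phi z) => //; rewrite phiK.
have [m /andP[um mw]] : exists r : R, (u%:E < r%:E < w%:E)%E.
  by apply: ereal_between; rewrite lte_fin.
have Fm : F (phi m%:E) by exists m%:E => //=; rewrite in_itv/= um.
have [I [bI Im]] := basic_cover (proj1 (FP _ Fm)) (proj2 (FP _ Fm)).
have FI : F `<=` I by exact: (basic_max bI Im Fm).
have psiF : psi @` F = `]u%:E, w%:E[%classic.
  rewrite /F image_comp; apply/seteqP; split=> [_ [z uzw <-]|z uzw] /=.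
    by rewrite phiK//; exact: uw_sub.
  by exists z => //=; rewrite phiK//; exact: uw_sub.
have len := real_length_image bI FI cF; rewrite psiF in len.
rewrite real_length_itv ?lte_fin// -EFinB -EFinM in len.
have ginj y z : (u%:E < y < w%:E)%E -> (u%:E < z < w%:E)%E -> g y = g z -> y = z.
  move=> uyw uzw; apply: (g_injective_basic bI).
    by exists (phi y); [apply: FI; exists y => //|rewrite phiK//; apply: uw_sub];
      rewrite /= in_itv.
  by exists (phi z); [apply: FI; exists z => //|rewrite phiK//; apply: uw_sub];
    rewrite /= in_itv.
have cg y z : (u%:E <= y)%E -> (z <= w%:E)%E -> order_convex (g @` `[y, z]).
  move=> uy zw; apply: (order_convex_image gcont); last exact: order_convex_itv.
  move=> v; rewrite /= in_itv/= => /andP[yv vz]; apply: uwcd.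
  by rewrite (le_trans uy yv) (le_trans vz zw).
set m1 := Order.min (g u%:E) (g w%:E); set m2 := Order.max (g u%:E) (g w%:E).
set G := g @` _ in len.
have cG : order_convex G.
  by apply: (order_convex_image gcont) => //; exact: order_convex_itv.
have uu : (g @` `[u%:E, w%:E]) (g u%:E).
  by exists u%:E => //=; rewrite in_itv/= lexx lee_fin ltW.
have ww : (g @` `[u%:E, w%:E]) (g w%:E).
  by exists w%:E => //=; rewrite in_itv/= lexx lee_fin ltW.
have m12 : (m1 <= m2)%E by rewrite /m1 /m2 ge_min !le_max lexx.
have m12E : m1 = g u%:E /\ m2 = g w%:E \/ m1 = g w%:E /\ m2 = g u%:E.
  by rewrite /m1 /m2; case: (leP (g u%:E) (g w%:E)); [left|right].
have inG : `]m1, m2[ `<=` G.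
  move=> k; rewrite /= in_itv/= => /andP[m1k km2].
  have [z zuw gz] : (g @` `[u%:E, w%:E]) k.
    have gc := cg u%:E w%:E (lexx _) (lexx _).
    case: m12E m1k km2 => -[-> ->] m1k km2; [apply: (gc _ _ uu ww)|apply: (gc _ _ ww uu)];
      by rewrite !ltW.
  exists z => //; move: zuw; rewrite /= !in_itv/= => /andP[uz zw].
  rewrite !lt_neqAle uz zw !andbT; apply/andP; split; apply/eqP => e; subst z.
    by move: m1k km2; rewrite -gz; case: m12E => -[-> ->]; rewrite ltxx.
  by move: m1k km2; rewrite -gz; case: m12E => -[-> ->]; rewrite ltxx.
have Gin : G `<=` `[m1, m2].
  move=> _ [z + <-]; rewrite /= !in_itv/= => /andP[uz zw].
  have gu := cg u%:E z (lexx _) (ltW zw); have gw := cg z w%:E (ltW uz) (lexx _).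
  have zz1 : (g @` `[u%:E, z]) (g z) by exists z => //=; rewrite in_itv/= lexx ltW.
  have zz2 : (g @` `[z, w%:E]) (g z) by exists z => //=; rewrite in_itv/= lexx ltW.
  have uu' : (g @` `[u%:E, z]) (g u%:E) by exists u%:E => //=; rewrite in_itv/= lexx ltW.
  have ww' : (g @` `[z, w%:E]) (g w%:E) by exists w%:E => //=; rewrite in_itv/= lexx ltW.
  (* If [g z] left [[m1, m2]], a value strictly between [g z] and that interval would be attained on
     both sides of [z], against injectivity. *)
  have twice k : (g @` `[u%:E, z]) k -> (g @` `[z, w%:E]) k ->
      k != g u%:E -> k != g w%:E -> k != g z -> False.
    move=> [x1 + <-] [x2 + gx2]; rewrite /= !in_itv/= => /andP[ux1 x1z] /andP[zx2 x2w].
    move=> nu; rewrite -gx2 => nw nz.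
    have zx2' : (z < x2)%E by rewrite lt_neqAle zx2 andbT; apply: contra nz => /eqP->.
    have ux1' : (u%:E < x1)%E by rewrite lt_neqAle ux1 andbT; apply: contra nu => /eqP->.
    have x2w' : (x2 < w%:E)%E by rewrite lt_neqAle x2w andbT; apply: contra nw => /eqP->.
    have := ginj x1 x2; rewrite gx2 ux1' x2w' (lt_trans uz zx2') (le_lt_trans x1z zw).
    by move=> /(_ isT isT erefl) x12; move: zx2'; rewrite -x12 ltNge x1z.
  apply/andP; split; rewrite leNgt; apply/negP => h.
    have [k /andP[zk km]] := ereal_between h.
    move: km; rewrite lt_min => /andP[ku kw].
    apply: (twice k%:E); rewrite ?(lt_eqF ku) ?(lt_eqF kw) ?(gt_eqF zk)//.
      by apply: (gu _ _ zz1 uu'); rewrite !ltW.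
    by apply: (gw _ _ zz2 ww'); rewrite !ltW.
  have [k /andP[mk kz]] := ereal_between h.
  move: mk; rewrite gt_max => /andP[ku kw].
  apply: (twice k%:E); rewrite ?(gt_eqF ku) ?(gt_eqF kw) ?(lt_eqF kz)//.
    by apply: (gu _ _ uu' zz1); rewrite !ltW.
  by apply: (gw _ _ ww' zz2); rewrite !ltW.
have lG0 : 0 < lambda * (w - u) by rewrite mulr_gt0// subr_gt0.
have cl : real_length `[m1, m2] = real_length `]m1, m2[.
  have -> : `[m1, m2]%classic = `]m1, m2[ `|` [set m1; m2] :> set (\bar R).
    apply/seteqP; split=> z; rewrite /= !in_itv/=.
      rewrite !le_eqVlt => /andP[/orP[/eqP e|m1z]]; first by move=> _; right; left.
      by move=> /orP[/eqP e|zm2]; [right; right|left; rewrite m1z].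
    by case=> [/andP[m1z zm2]|[->|->]]; rewrite ?lexx ?m12 ?ltW.
  apply: real_lengthU_countable; first exact: order_convex_itv.
  by apply: finite_set_countable.
have lG : real_length `]m1, m2[ = (lambda * (w - u))%:E.
  apply/eqP; rewrite eq_le -len; apply/andP; split.
    by apply: le_real_length inG => //; exact: order_convex_itv.
  by rewrite -cl; apply: le_real_length Gin => //; exact: order_convex_itv.
have {m12} m12 : (m1 < m2)%E.
  rewrite lt_neqAle m12 andbT; apply/eqP => m12e; move: lG; rewrite m12e.
  rewrite set_itvoo0 ?le_refl// /real_length preimage_set0 measure0 => -[] /eqP.
  by rewrite lt_eqF.
rewrite real_length_itv// in lG.
(* The finite length of []m1, m2[] excludes infinite endpoints. *)
have [s1 [t1 [m1E m2E st]]] : exists s t : R, [/\ m1 = s%:E, m2 = t%:E & t - s = lambda * (w - u)].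
  by move: m1 m2 lG m12 {m12E inG Gin cl} => [s||] [t||]// [] st _; exists s, t.
have ts : 0 < t1 - s1 by rewrite st.
case: m12E => -[gE gE']; rewrite -gE -gE' m1E m2E; [exists s1, t1|exists t1, s1]; split=> //.
  by rewrite distrC gtr0_norm.
by rewrite gtr0_norm.
Qed.


(** * Finiteness of lengths from transitivity, and the eigenvector *)

Hypothesis ftrans : topologically_transitive a b f.

Let iter_fun n x : x \in `[a, b] -> iter n f x \in `[a, b].
Proof. by move=> xab; elim: n => //= n; exact: f_fun. Qed.

(** Orbits of [g] that start in [U] never leave it, while transitivity of [f], read through [psi],
    brings one of them into [V]. *)
Lemma transitive_psi (U V : set (\bar R)) : open U -> open V ->
  U `&` `[c, d] !=set0 -> V `&` `[c, d] !=set0 ->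
  (forall y, y \in `[c, d] -> U y -> U (g y)) -> U `&` V !=set0.
Proof.
move=> oU oV [u [Uu ucd]] [v [Vv vcd]] gU.
have pull W : open W -> exists X, open X /\ X `&` `[a, b] = psi @^-1` W `&` `[a, b].
  move=> oW; have /continuousP/(_ _ oW)/open_subspaceP[X oX XE] := psi_cont.
  by exists X.
have [U' [oU' UE]] := pull _ oU; have [V' [oV' VE]] := pull _ oV.
have [||n [_ [[x + <-]]]] := ftrans oU' oV'.
- by exists (phi u); rewrite UE; split; [rewrite /preimage/= phiK|exact: phi_fun].
- by exists (phi v); rewrite VE; split; [rewrite /preimage/= phiK|exact: phi_fun].
rewrite UE VE => -[Ux xab] [Vx _]; exists (psi (iter n f x)); split=> //.
elim: n {Vx} => //= n IH; rewrite fg; last exact: iter_fun.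
by apply: gU => //; exact/psi_fun/iter_fun.
Qed.

Lemma basic_finite_or_infinite I J : basic_intervals a b P I -> basic_intervals a b P J ->
  (real_length (psi @` I) < +oo)%E -> (real_length (psi @` J) < +oo)%E.
Proof.
move=> bI bJ Ifin; apply: contrapT => Jinf.
have [_ _ _ Pab _ _ _ _ fPP _] := fP.
have Iab K : basic_intervals a b P K -> K `&` `[a, b] !=set0.
  move=> bK; have [r Kr] := basic_ex_fin fP bK.
  by exists r%:E; split=> //; exact: basic_in Kr.
have [n [_ [[x [Ix xab] <-] [Jx _]]]] :=
  ftrans (basic_open fP bI) (basic_open fP bJ) (Iab _ bI) (Iab _ bJ).
(* [S] is vacuous at points of [P], so it propagates along orbits that hit the partition set: [P] is
   invariant, and off [P] the next basic interval lies in the image of the previous one, whose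
   length is multiplied by [lambda]. *)
pose S x := forall K, basic_intervals a b P K -> K x -> (real_length (psi @` K) < +oo)%E.
suff Sx : S (iter n f x) by apply: Jinf; exact: (Sx J).
elim: n {Jx} => [|n IH] /=.
  by move=> K bK Kx; rewrite (basic_eq bK bI Kx Ix).
move=> K bK Kfx; set y := iter n f x in IH Kfx.
have yab : y \in `[a, b] by exact: iter_fun.
have [Py|nPy] := pselect (P y).
  by have [_] := basic_sub bK Kfx; case; apply: fPP; exists y.
have [L [bL Ly]] := basic_cover yab nPy.
have KL : K `<=` f @` L.
  by apply: basic_image_sub => //; exists (f y); split=> //; exists y.
have Lab : L `<=` `[a, b] by move=> z; exact: basic_in.
apply: (@le_lt_trans _ _ (real_length (psi @` (f @` L)))).
  apply: le_real_length; last exact: image_subset.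
    by apply: order_convex_psi; [move=> z; exact: basic_in|exact: (basic_convex fP bK)].
  rewrite psi_image_image//; have [_ _ gcont _ _ _ _ _ _ _] := gQ.
  apply: (order_convex_image gcont); first by move=> _ [z Lz <-]; exact/psi_fun/Lab.
  by apply: order_convex_psi => //; exact: (basic_convex fP bL).
rewrite psi_image_image// (real_length_image bL)//; last exact: (basic_convex fP bL).
by apply: lte_mul_pinfty => //; [rewrite lee_fin ltW|exact: IH].
Qed.

Lemma basic_finite I : basic_intervals a b P I -> (real_length (psi @` I) < +oo)%E.
Proof.
move=> bI; apply: contrapT => Iinf.
have inf J : basic_intervals a b P J -> ~ (real_length (psi @` J) < +oo)%E.
  by move=> bJ; apply: contra_not Iinf; exact: basic_finite_or_infinite.
have [_ _ _ Pab _ cP _ _ _ _] := fP.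
have cpP : countable (psi @` P) by apply: (card_le_trans (card_image_le _ _)).
(* Between two finite points of [psi @` P] there would be a bounded basic interval. *)
have one (u w : R) : (psi @` P) u%:E -> (psi @` P) w%:E -> ~ u < w.
  move=> [x Px xu] [y Py yw] uw.
  have [|r [/andP[ur rw] nr]] := countable_avoid (u := u%:E) (w := w%:E) cpP.
    by rewrite lte_fin.
  have rcd : r%:E \in `[c, d].
    apply: (@order_convex_itv _ `[c, d] u%:E w%:E); rewrite ?(ltW ur) ?(ltW rw)//.
      by rewrite -xu; exact/psi_fun/Pab.
    by rewrite -yw; exact/psi_fun/Pab.
  have nPr : ~ P (phi r%:E) by move=> Pr; apply: nr; exists (phi r%:E) => //; rewrite phiK.
  have [J [bJ Jr]] := basic_cover (phi_fun rcd) nPr.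
  have cJ : order_convex (psi @` J).
    by apply: order_convex_psi; [move=> z; exact: basic_in|exact: (basic_convex fP bJ)].
  have Jr' : (psi @` J) r%:E by exists (phi r%:E) => //; rewrite phiK.
  have nJ p : P p -> ~ (psi @` J) (psi p).
    move=> Pp [z Jz /psi_inj zp]; have [zab nPz] := basic_sub bJ Jz.
    by apply: nPz; rewrite zp//; exact: Pab.
  apply: (inf J bJ); apply: (@le_lt_trans _ _ (real_length `]u%:E, w%:E[)); last first.
    by rewrite real_length_itv ?lte_fin// -EFinB ltry.
  apply: le_real_length => //; first exact: order_convex_itv.
  move=> z Jz; rewrite /= in_itv/= !ltNge; apply/andP; split; apply/negP => h.
    by apply: (nJ x Px); rewrite xu; apply: (cJ _ _ Jz Jr'); rewrite h ltW.
  by apply: (nJ y Py); rewrite yw; apply: (cJ _ _ Jr' Jz); rewrite h andbT ltW.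
have cd : (c < d)%E by case: gQ.
(* [p] is the only finite point of psi(P) if there is one, and otherwise any finite point of
   [[c, d]]. On each side of [p], [scaling_off_partition] then multiplies distances to [p] by
   [lambda]. *)
have [p [pcd pP]] : exists p : R, p%:E \in `[c, d] /\
    forall u : R, u != p -> ~ (psi @` P) u%:E.
  have [[p Pp]|np] := pselect (exists p : R, (psi @` P) p%:E).
    exists p; split; first by have [x Px <-] := Pp; exact/psi_fun/Pab.
    by move=> u up Pu; have [/one|/one|/eqP] := ltgtP u p; [exact|exact|rewrite (negbTE up)].
  have [p /andP[cp pd]] := ereal_between cd.
  exists p; split; first by rewrite in_itv/= !ltW.
  by move=> u _ Pu; apply: np; exists u.
have scale (x : R) : x%:E \in `[c, d] -> x != p ->
    exists s t : R, [/\ g p%:E = s%:E, g x%:E = t%:E & `|s - t| = lambda * `|p - x|].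
  move=> xcd xp; have free (u w : R) : p = u \/ p = w ->
      forall z, (u%:E < z < w%:E)%E -> ~ (psi @` P) z.
    move=> puw [z||]; last 2 first.
    - by move=> /andP[].
    - by move=> /andP[].
    by rewrite !lte_fin => /andP[uz zw]; apply: pP; case: puw => ->;
      [rewrite gt_eqF|rewrite lt_eqF].
  have [xp'|px|xp'] := ltgtP x p; last by move: xp; rewrite xp' eqxx.
    have [s [t [gx gp st]]] := scaling_off_partition xcd pcd xp' (free _ _ (or_intror erefl)).
    by exists t, s; split=> //; rewrite distrC st gtr0_norm ?subr_gt0.
  have [s [t [gp gx st]]] := scaling_off_partition pcd xcd px (free _ _ (or_introl erefl)).
  by exists s, t; split=> //; rewrite st distrC gtr0_norm ?subr_gt0.
have unbounded (M : R) : exists x : R, x%:E \in `[c, d] /\ M < `|x - p|.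
  apply: contrapT => /forallNP nM; apply: (inf I bI).
  have Iab : I `<=` `[a, b] by move=> z; exact: basic_in.
  apply: (@le_lt_trans _ _ (@lebesgue_measure R `[p - M, p + M])); last first.
    by rewrite lebesgue_measure_itv/=; case: ifP => _; rewrite -?EFinB ltry.
  apply: le_measure; rewrite ?inE//=.
    apply: measurable_order_convex; apply: order_convex_psi => //.
    exact: (basic_convex fP bI).
  move=> x [z Iz zx]; rewrite /= in_itv/= -ler_distl leNgt; apply/negP => Mx.
  by apply: (nM x); split=> //; rewrite -zx; exact/psi_fun/Iab.
have [y0 gp] : exists y0 : R, g p%:E = y0%:E.
  have [x [xcd x0]] := unbounded 0; have [|s [t [gps _ _]]] := scale x xcd; last by exists s.
  by rewrite -subr_eq0 -normr_gt0.
(* This makes [(lambda - 1) * M] exceed the displacement [|y0 - p|] of [p], so [g] increases the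
   distance to [p] of every finite point farther than [M]. *)
pose M := `|y0 - p| / (lambda - 1) + 1.
have M0 : 0 < M.
  by rewrite ltr_wpDl// divr_ge0// subr_ge0 ltW.
have ME : (lambda - 1) * M = `|y0 - p| + (lambda - 1).
  by rewrite /M mulrDr mulr1 mulrC divfK// subr_eq0 gt_eqF.
(* The infinite points are left out because [scale] concerns finite points only; [U] is still open
   and forward invariant. *)
pose U := `](p + M)%:E, +oo%E[ `|` `]-oo%E, (p - M)%:E[ : set (\bar R).
have UE z : U z <-> exists x : R, z = x%:E /\ M < `|x - p|.
  split.
    case; rewrite /= in_itv/= => /andP[].
      case: z => [x||]// + _; rewrite lte_fin => px; exists x; split=> //.
      by apply: lt_le_trans (ler_norm _); lra.
    case: z => [x||]// _; rewrite lte_fin => px; exists x; split=> //.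
    by rewrite distrC; apply: lt_le_trans (ler_norm _); lra.
  move=> [x [-> ]]; case: (leP p x) => px.
    by rewrite ger0_norm ?subr_ge0// => Mx; left; rewrite /= in_itv/= ltry lte_fin; lra.
  by rewrite ltr0_norm ?subr_lt0// => Mx; right; rewrite /= in_itv/= ltNyr lte_fin; lra.
have oU : open U by apply: openU; exact: itv_open.
have [] := @transitive_psi U `](p - M)%:E, (p + M)%:E[ oU (itv_open _ _).
- by have [x [xcd Mx]] := unbounded M; exists x%:E; split=> //; apply/UE; exists x.
- by exists p%:E; split=> //=; rewrite in_itv/= !lte_fin; apply/andP; split; lra.
- move=> z zcd /UE[x [zx Mx]]; subst z.
  have [|s [t [gps -> st]]] := scale x zcd.
    by rewrite -subr_eq0 -normr_gt0 (lt_trans M0).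
  apply/UE; exists t; split=> //.
  have e : s = y0 by case: (etrans (esym gps) gp).
  rewrite e (distrC p x) in st.
  have := ler_distD y0 t p; have := ler_distD p t y0; rewrite (distrC t y0) st (distrC p y0).
  have : (lambda - 1) * M < (lambda - 1) * `|x - p| by rewrite ltr_pM2l ?subr_gt0.
  rewrite ME mulrBl mul1r; set A := `|x - p|; set B := lambda * A; set C := `|y0 - p|.
  by set D := `|t - p|; move: lambda1 Mx; rewrite -/A; lra.
- move=> z [/UE[x [-> Mx]]]; rewrite /= in_itv/= !lte_fin => /andP[p1 p2].
  by move: Mx; rewrite ltNge ler_distl => /negP; apply; rewrite !ltW.
Qed.

Lemma psi_interior x : (a < x < b)%E -> exists e : R, psi x = e%:E.
Proof.
move=> /andP[ax xb]; have xab : x \in `[a, b] by rewrite in_itv/= !ltW.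
have ab := lt_trans ax xb.
have aab : a \in `[a, b] by rewrite in_itv/= lexx ltW.
have bab : b \in `[a, b] by rewrite in_itv/= lexx ltW.
(* Removing [x] disconnects [a, b], but removing an endpoint of [c, d] does not. *)
have nconv : ~ order_convex (psi @` `[a, b] `\ psi x).
  set E := psi @` _ `\ _ => cE.
  have Ecd : E `<=` `[c, d] by move=> _ [[z zab <-] _]; exact: psi_fun.
  have cphi : order_convex (phi @` E) := order_convex_image phi_cont Ecd cE.
  have inE z : z \in `[a, b] -> z != x -> (phi @` E) z.
    move=> zab zx; exists (psi z); last by rewrite psiK.
    by split; [exists z|move=> /= /(psi_inj zab xab) e; rewrite e eqxx in zx].
  have [_ [[z zab <-] /= nzx]] : (phi @` E) x.
    apply: (cphi a b); [apply: inE => //|apply: inE => //|by rewrite !ltW].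
      by rewrite lt_eqF.
    by rewrite gt_eqF.
  by rewrite psiK// => zx; apply: nzx; rewrite zx.
have psicd : psi @` `[a, b] = `[c, d]%classic.
  apply/seteqP; split=> [_ [z zab <-]|z zcd]; first exact: psi_fun.
  by exists (phi z); [exact: phi_fun|exact: phiK].
rewrite psicd in nconv.
have /= := psi_fun xab; rewrite in_itv/= => /andP[cx xd].
have cx' : (c < psi x)%E.
  rewrite lt_neqAle cx andbT; apply/eqP => e; apply: nconv; rewrite -e.
  by rewrite setDitv1l; exact: order_convex_itv.
have xd' : (psi x < d)%E.
  rewrite lt_neqAle xd andbT; apply/eqP => e; apply: nconv; rewrite e.
  by rewrite setDitv1r; exact: order_convex_itv.
by move: cx' xd'; case: (psi x) => [e||]; rewrite ?ltNge ?leey ?leNye//; exists e.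
Qed.

(** The last clause is what the counterexample contradicts: at an interior point [psi x] is finite,
    and an interval of length [e] around it pulls back to a neighbourhood in which every basic
    interval has length at most [e]. At [a] and [b] the value of [psi] may be infinite. *)
Lemma conjugacy_eigenvector : exists v : basic_intervals a b P -> R,
  [/\ nonneg_eigenvector f lambda v, forall K, 0 < v K
    & forall x, (a < x < b)%E -> forall e : R, 0 < e ->
      exists2 X, open X /\ X x
        & forall K : basic_intervals a b P, (set_val K : set (\bar R)) `<=` X -> v K <= e].
Proof.
pose v (K : basic_intervals a b P) : R := fine (real_length (psi @` (set_val K : set (\bar R)))).
have vE K : (v K)%:E = real_length (psi @` (set_val K : set (\bar R))).
  rewrite fineK// ge0_fin_numE ?real_length_ge0//; exact: basic_finite (set_valP K).
have v0 K : 0 < v K by rewrite -lte_fin vE; exact: real_length_basic_gt0 (set_valP K).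
exists v; split=> //.
  split; last 2 first.
  - by move=> K; exact: ltW.
  - move=> K; have bK := set_valP K.
    have Kab : (set_val K : set (\bar R)) `<=` `[a, b] by move=> z; exact: basic_in.
    rewrite EFinM vE -(real_length_image bK)//; last exact: (basic_convex fP bK).
    rewrite -psi_image_image// esum_real_length_image// [RHS]esum_mkcond.
    apply: eq_esum => J _; rewrite /transition_matrix.
    case: ifPn => [/set_mem h|/negP h].
      by rewrite asboolT// mul1r vE.
    by rewrite asboolF ?mul0r// => h'; apply: h; rewrite inE.
  have [ab _ _ _ _ cP _ _ _ _] := fP.
  have [r [/andP[ar rb] nPr]] := countable_avoid cP ab.
  have [|K [bK _]] := @basic_cover R a b P r%:E _ nPr; first by rewrite in_itv/= !ltW.
  by exists (SigSub (mem_set bK)); rewrite gt_eqF.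
move=> x axb e e0; have [y pxy] := psi_interior axb.
have /continuousP/(_ _ (itv_open (y - e / 2)%:E (y + e / 2)%:E))/open_subspaceP[X oX XE]
  := psi_cont.
have xab : x \in `[a, b] by case/andP: axb => ax xb; rewrite in_itv/= !ltW.
exists X.
  have pin : psi x \in `](y - e / 2)%:E, (y + e / 2)%:E[.
    by rewrite pxy in_itv/= !lte_fin; apply/andP; split; lra.
  have : (X `&` `[a, b]) x by rewrite XE.
  by case.
move=> K KX; rewrite -lee_fin vE; have bK := set_valP K.
apply: (@le_trans _ _ (real_length `](y - e / 2)%:E, (y + e / 2)%:E[)).
  apply: le_real_length; last 2 first.
  - exact: order_convex_itv.
  - move=> _ [z Kz <-]; suff : (X `&` `[a, b]) z by rewrite XE => -[].
    by split; [exact: KX|exact: basic_in Kz].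
  by apply: order_convex_psi; [move=> z; exact: basic_in|exact: (basic_convex fP bK)].
rewrite real_length_itv ?lte_fin; last by lra.
by rewrite -EFinB lee_fin; lra.
Qed.

End conjugacy.

(** * The counterexample *)

Section zigzag.
Context {R : realType}.
Implicit Types (y z p q : R) (n m k : nat).

(** The image of the integer [n]. Truncated subtraction fixes 0, so the first unit interval is sent
    onto [0, 4] instead of continuing the pattern below 0. *)
Definition vtx n : nat := if odd n then n.+3 else (n - 2)%N.
Definition vlo n : nat := minn (vtx n) (vtx n.+1).
Definition vhi n : nat := maxn (vtx n) (vtx n.+1).

Lemma vtx_bounds n : (n <= vtx n + 2)%N /\ (vtx n <= n + 3)%N.
Proof. by rewrite /vtx; case: (odd n); lia. Qed.

Lemma vlo_double k : vlo k.*2 = (k.*2 - 2)%N.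
Proof. by rewrite /vlo /vtx /= odd_double /=; lia. Qed.

Lemma vlo_doubleS k : vlo k.*2.+1 = k.*2.
Proof. by rewrite /vlo /vtx /= odd_double /=; lia. Qed.

Lemma vhi_double k : vhi k.*2 = (k.*2 + 4)%N.
Proof. by rewrite /vhi /vtx /= odd_double /=; lia. Qed.

Lemma vhi_doubleS k : vhi k.*2.+1 = (k.*2 + 4)%N.
Proof. by rewrite /vhi /vtx /= odd_double /=; lia. Qed.

Lemma vlo_vhi n : (vlo n + 4 <= vhi n)%N.
Proof.
by rewrite -(odd_double_half n); case: (odd n); rewrite ?add1n ?add0n
  ?vlo_double ?vlo_doubleS ?vhi_double ?vhi_doubleS; lia.
Qed.

Definition zigzag y : R :=
  let n := Num.truncn y in
  (vtx n)%:R + (y - n%:R) * ((vtx n.+1)%:R - (vtx n)%:R).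

Lemma zigzagE n y : n%:R <= y <= n.+1%:R ->
  zigzag y = (vtx n)%:R + (y - n%:R) * ((vtx n.+1)%:R - (vtx n)%:R).
Proof.
move=> /andP[ny]; rewrite le_eqVlt => /orP[/eqP->|yn].
  by rewrite /zigzag natrK subrr mul0r addr0 -[in RHS]natr1; ring.
by rewrite /zigzag (@truncn_def _ y n)// ny.
Qed.

Lemma in_unit y : 0 <= y -> exists n, n%:R <= y < n.+1%:R.
Proof. by move=> y0; exists (Num.truncn y); exact: truncn_itv. Qed.

Lemma zigzag_between n y : n%:R <= y <= n.+1%:R -> (vlo n)%:R <= zigzag y <= (vhi n)%:R.
Proof.
move=> /[dup] ny /zigzagE ->; move: ny; rewrite -natr1 => /andP[ny yn].
rewrite /vlo /vhi; case: (leqP (vtx n) (vtx n.+1)) => h.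
  have : (vtx n)%:R <= (vtx n.+1)%:R :> R by rewrite ler_nat.
  by move=> ?; apply/andP; split; nra.
have : (vtx n.+1)%:R <= (vtx n)%:R :> R by rewrite ler_nat ltnW.
by move=> ?; apply/andP; split; nra.
Qed.

Lemma zigzag_strictly_between n y : n%:R < y < n.+1%:R ->
  (vlo n)%:R < zigzag y < (vhi n)%:R.
Proof.
move=> /andP[ny yn]; rewrite (@zigzagE n) ?ny ?ltW//; move: yn; rewrite -natr1 => yn.
have := vlo_vhi n; rewrite /vlo /vhi; case: (leqP (vtx n) (vtx n.+1)) => _ h.
  have d : 0 < (vtx n.+1)%:R - (vtx n)%:R :> R by rewrite subr_gt0 ltr_nat; lia.
  have d1 : 0 < (y - n%:R) * ((vtx n.+1)%:R - (vtx n)%:R) by apply: mulr_gt0 => //; lra.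
  have d2 : 0 < (n%:R + 1 - y) * ((vtx n.+1)%:R - (vtx n)%:R) by apply: mulr_gt0 => //; lra.
  by apply/andP; split; nra.
have d : 0 < (vtx n)%:R - (vtx n.+1)%:R :> R by rewrite subr_gt0 ltr_nat; lia.
have d1 : 0 < (y - n%:R) * ((vtx n)%:R - (vtx n.+1)%:R) by apply: mulr_gt0 => //; lra.
have d2 : 0 < (n%:R + 1 - y) * ((vtx n)%:R - (vtx n.+1)%:R) by apply: mulr_gt0 => //; lra.
by apply/andP; split; nra.
Qed.

Lemma zigzag_ge0 y : 0 <= y -> 0 <= zigzag y.
Proof.
move=> /in_unit[n /andP[ny yn]].
have /andP[+ _] : (vlo n)%:R <= zigzag y <= (vhi n)%:R.
  by apply: zigzag_between; rewrite ny ltW.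
by apply: le_trans.
Qed.

(** This bound on downward displacement keeps points near infinity near infinity, which makes the
    glued map continuous at 0. *)
Lemma zigzag_ge y : 0 <= y -> y - 3 <= zigzag y.
Proof.
move=> /in_unit[n /andP[ny yn]].
have /andP[h _] : (vlo n)%:R <= zigzag y <= (vhi n)%:R by apply: zigzag_between; rewrite ny ltW.
have : (n <= vlo n + 2)%N.
  by have := vtx_bounds n; have := vtx_bounds n.+1; rewrite /vlo; lia.
by rewrite -(ler_nat R) natrD => ?; move: yn; rewrite -natr1 => ?; lra.
Qed.

Lemma zigzag_lip y z : 0 <= y <= z -> `|zigzag y - zigzag z| <= 6 * (z - y).
Proof.
move=> /andP[y0 yz]; have z0 := le_trans y0 yz.
have [n /andP[ny yn]] := in_unit y0; have [m /andP[mz zm]] := in_unit z0.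
have slope i : `|(vtx i.+1)%:R - (vtx i)%:R| <= 6 :> R.
  have [h1 h2] := vtx_bounds i; have [h3 h4] := vtx_bounds i.+1.
  by move: h1 h2 h3 h4; rewrite -!(ler_nat R) !natrD -natr1 ler_norml => *; lra.
have nm : (n <= m)%N by rewrite -ltnS -(ltr_nat R); apply: le_lt_trans ny (le_lt_trans yz zm).
have seg i u w : i%:R <= u -> u <= w -> w <= i.+1%:R -> `|zigzag u - zigzag w| <= 6 * (w - u).
  move=> iu uw wi; rewrite !(@zigzagE i) ?iu ?wi ?(le_trans iu uw) ?(le_trans uw wi)//.
  set A := (vtx i.+1)%:R - (vtx i)%:R.
  have -> : (vtx i)%:R + (u - i%:R) * A - ((vtx i)%:R + (w - i%:R) * A) = (u - w) * A by ring.
  have -> : `|(u - w) * A| = `|A| * (w - u).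
    by rewrite normrM mulrC (distrC u w) (@ger0_norm _ (w - u)) ?subr_ge0.
  by apply: ler_wpM2r; [rewrite subr_ge0|exact: slope].
move: nm; rewrite leq_eqVlt => /orP[/eqP nm|nm]; first by apply: (seg n) => //; rewrite nm ltW.
have zz i : zigzag i%:R = (vtx i)%:R.
  by rewrite (@zigzagE i) ?lexx ?ler_nat ?leqnSn// subrr mul0r addr0.
(* Vertex values exceed their index by at most 3 and fall below it by at most 2, so at integer
   distance d >= 1 they differ by at most d + 5, hence by at most 6 d. *)
have mid : `|zigzag n.+1%:R - zigzag m%:R| <= 6 * (m%:R - n.+1%:R).
  rewrite !zz; move: nm; rewrite leq_eqVlt => /orP[/eqP->|nm]; first by rewrite !subrr normr0 mulr0.
  have [h1 h2] := vtx_bounds n.+1; have [h3 h4] := vtx_bounds m.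
  move: nm h1 h2 h3 h4; rewrite -!(ler_nat R) !natrD -!natr1 ler_norml => *; lra.
have l := seg n _ _ ny (ltW yn) (lexx _).
have mle : m%:R <= m.+1%:R :> R by rewrite ler_nat leqnSn.
have r := seg m _ _ (lexx _) mz (ltW zm).
apply: (le_trans (ler_distD (zigzag n.+1%:R) _ _)).
have := ler_distD (zigzag m%:R) (zigzag n.+1%:R) (zigzag z); lra.
Qed.

(* On a unit interval the slope is at least 4 in absolute value. *)
Lemma zigzag_stretch n p q : n%:R <= p -> p < q -> q <= n.+1%:R ->
  exists p' q', [/\ 0 <= p', 4 * (q - p) <= q' - p'
    & forall z, p' < z < q' -> exists2 y, p < y < q & zigzag y = z].
Proof.
move=> np pq qn; pose A : R := (vtx n.+1)%:R - (vtx n)%:R.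
have p0 : 0 <= p by apply: le_trans np.
have ZE y : p <= y <= q -> zigzag y = (vtx n)%:R + (y - n%:R) * A.
  by move=> /andP[py yq]; apply: zigzagE; rewrite (le_trans np py) (le_trans yq qn).
have pe : zigzag p = (vtx n)%:R + (p - n%:R) * A by apply: ZE; rewrite lexx ltW.
have qe : zigzag q = (vtx n)%:R + (q - n%:R) * A by apply: ZE; rewrite lexx ltW.
have [A4|A4] : 4 <= A \/ A <= -4.
  have := vlo_vhi n; rewrite /vlo /vhi /A; case: (leqP (vtx n) (vtx n.+1)) => _ h; [left|right].
    by move: h; rewrite -(ler_nat R) natrD; lra.
  by move: h; rewrite -(ler_nat R) natrD; lra.
- exists (zigzag p), (zigzag q); split; first exact: zigzag_ge0.
    by rewrite pe qe; nra.
  move=> z /andP[pz zq]; have A0 : 0 < A by lra.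
  have h : p < n%:R + (z - (vtx n)%:R) / A < q.
    apply/andP; split.
      by rewrite -ltrBlDl ltr_pdivlMr//; move: pz; rewrite pe; lra.
    by rewrite -ltrBrDl ltr_pdivrMr//; move: zq; rewrite qe; lra.
  exists (n%:R + (z - (vtx n)%:R) / A) => //.
  rewrite ZE; first by field; rewrite gt_eqF.
  by case/andP: h => h1 h2; rewrite !ltW.
- exists (zigzag q), (zigzag p); split; first by apply: zigzag_ge0; rewrite (le_trans p0) ?ltW.
    by rewrite pe qe; nra.
  move=> z /andP[qz zp]; have A0 : A < 0 by lra.
  have h : p < n%:R + (z - (vtx n)%:R) / A < q.
    apply/andP; split.
      by rewrite -ltrBlDl ltr_ndivlMr//; move: zp; rewrite pe; lra.
    by rewrite -ltrBrDl ltr_ndivrMr//; move: qz; rewrite qe; lra.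
  exists (n%:R + (z - (vtx n)%:R) / A) => //.
  rewrite ZE; first by field; rewrite lt_eqF.
  by case/andP: h => h1 h2; rewrite !ltW.
Qed.

Lemma zigzag_onto n z : (vlo n)%:R < z < (vhi n)%:R ->
  exists2 y, n%:R < y < n.+1%:R & zigzag y = z.
Proof.
pose A : R := (vtx n.+1)%:R - (vtx n)%:R; pose y := n%:R + (z - (vtx n)%:R) / A.
move=> h; suff nyn : n%:R < y < n.+1%:R.
  exists y => //; rewrite (@zigzagE n); last by case/andP: nyn => *; rewrite !ltW.
  have A0 : A != 0.
    rewrite /A subr_eq0 eqr_nat; have := vlo_vhi n; rewrite /vlo /vhi.
    by case: (leqP (vtx n) (vtx n.+1)); lia.
  by rewrite -/A /y; field.
move: h; have := vlo_vhi n; rewrite /vlo /vhi; case: (leqP (vtx n) (vtx n.+1)) => _ d /andP[lz zh].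
  have A0 : 0 < A by rewrite subr_gt0 ltr_nat; lia.
  by rewrite /y -natr1 ltrDl ltrD2l ltr_pdivlMr// ltr_pdivrMr// /A; apply/andP; split; lra.
have A0 : A < 0 by rewrite subr_lt0 ltr_nat; lia.
by rewrite /y -natr1 ltrDl ltrD2l ltr_ndivlMr// ltr_ndivrMr// /A; apply/andP; split; lra.
Qed.

End zigzag.

(** * Two exchanged copies of the zigzag glued into [-1, 1] *)

Section example.
Context {R : realType}.
Implicit Types (x y z u v p q : R) (n m k : nat) (e : bool).

(* The pairs (e, y) are coordinates on [-1, 1] minus 0; y = oo corresponds to 0. *)
Definition pt e y : R := (-1) ^+ e / (1 + y).

Lemma pt_gt0 y : 0 <= y -> 0 < 1 + y. Proof. by move=> ?; lra. Qed.

Lemma ptN e y : pt (~~ e) y = - pt e y.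
Proof. by rewrite /pt; case: e; rewrite /= ?expr0 ?expr1 ?mulN1r ?mul1r ?mulNr ?opprK. Qed.

Lemma norm_pt e y : 0 <= y -> `|pt e y| = (1 + y)^-1.
Proof.
by move=> /pt_gt0 y0; rewrite /pt normrM normr_sign mul1r gtr0_norm// invr_gt0.
Qed.

Lemma pt_neq0 e y : 0 <= y -> pt e y != 0.
Proof. by move=> y0; rewrite -normr_eq0 norm_pt// invr_eq0 gt_eqF// pt_gt0. Qed.

Lemma pt_inj e e' y z : 0 <= y -> 0 <= z -> pt e y = pt e' z -> e = e' /\ y = z.
Proof.
move=> y0 z0 yz; have := congr1 Num.norm yz; rewrite !norm_pt// => /invr_inj/addrI yz'.
split=> //; move: yz; rewrite yz' /pt => /mulIf.
have : (1 + z)^-1 != 0 by rewrite invr_eq0 gt_eqF// pt_gt0.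
move=> h /(_ h); case: e e' => -[]//; rewrite ?expr0 ?expr1 => ?; exfalso; lra.
Qed.

Lemma pt_range e y : 0 <= y -> -1 <= pt e y <= 1.
Proof.
by move=> y0; rewrite -ler_norml norm_pt// invf_le1 ?lerDl// pt_gt0.
Qed.

Lemma pt_cover x : -1 <= x <= 1 -> x = 0 \/ exists e y, 0 <= y /\ x = pt e y.
Proof.
move=> x1; have [->|x0] := eqVneq x 0; [by left|right].
exists (x < 0), (`|x|^-1 - 1); split.
  by rewrite subr_ge0 invf_ge1 ?normr_gt0// ler_norml.
by rewrite /pt addrC subrK invrK -numEsign.
Qed.

Lemma pt_dist e y z : 0 <= y -> 0 <= z ->
  `|pt e y - pt e z| = `|y - z| / ((1 + y) * (1 + z)).
Proof.
move=> /pt_gt0 y0 /pt_gt0 z0.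
have -> : pt e y - pt e z = (-1) ^+ e * ((z - y) / ((1 + y) * (1 + z))).
  by rewrite /pt; field; rewrite !gt_eqF.
rewrite normrM normr_sign mul1r normrM distrC (@gtr0_norm _ (_^-1))//.
by rewrite invr_gt0 mulr_gt0.
Qed.

Lemma pt_distN e y z : 0 <= y -> 0 <= z ->
  `|pt e y - pt (~~ e) z| = (1 + y)^-1 + (1 + z)^-1.
Proof.
move=> /pt_gt0 y0 /pt_gt0 z0.
have -> : pt e y - pt (~~ e) z = (-1) ^+ e * ((1 + y)^-1 + (1 + z)^-1).
  by rewrite ptN /pt; field; rewrite !gt_eqF.
by rewrite normrM normr_sign mul1r ger0_norm// addr_ge0// invr_ge0 ltW.
Qed.

(** Here [|x|^-1 - 1] recovers the coordinate [y] of [x], and the minus sign before [Num.sg x]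
    exchanges the copies. *)
Definition swap_fun x : R :=
  if x == 0 then 0 else - Num.sg x / (1 + zigzag (`|x|^-1 - 1)).

Lemma swap_fun_pt e y : 0 <= y -> swap_fun (pt e y) = pt (~~ e) (zigzag y).
Proof.
move=> y0; rewrite /swap_fun (negbTE (pt_neq0 _ y0)) norm_pt// invrK.
have -> : 1 + y - 1 = y by ring.
rewrite ptN /pt mulNr; congr (- (_ / _)).
rewrite sgrM (@gtr0_sg _ (_^-1)) ?invr_gt0 ?pt_gt0// mulr1.
by case: (e); rewrite ?expr0 ?expr1 ?sgrN ?sgr1.
Qed.

Lemma swap_fun_range x : -1 <= x <= 1 -> -1 <= swap_fun x <= 1.
Proof.
move=> /pt_cover[->|[e [y [y0 ->]]]]; first by rewrite /swap_fun eqxx lerN10 ler01.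
by rewrite swap_fun_pt// pt_range// zigzag_ge0.
Qed.

Lemma zigzag_inv_le y : 0 <= y -> (1 + zigzag y)^-1 <= 4 / (1 + y).
Proof.
move=> y0; have := zigzag_ge0 y0; have := zigzag_ge y0 => h1 h2.
by rewrite ler_pdivlMr ?pt_gt0// mulrC ler_pdivrMr ?pt_gt0//; lra.
Qed.

(** Within one copy, 96 = 6 * 4 * 4 combines the Lipschitz constant of [zigzag] with the factor 4 of
    [zigzag_inv_le] at each point. Across the copies, distances to 0 add up and the factor 4
    suffices. *)
Lemma swap_fun_lip x z : -1 <= x <= 1 -> -1 <= z <= 1 ->
  `|swap_fun x - swap_fun z| <= 96 * `|x - z|.
Proof.
have swap_fun0 : swap_fun 0 = 0 by rewrite /swap_fun eqxx.
have zero u : -1 <= u <= 1 -> `|swap_fun u| <= 4 * `|u|.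
  move=> /pt_cover[->|[e [y [y0 ->]]]]; first by rewrite /swap_fun eqxx normr0 mulr0.
  by rewrite swap_fun_pt// !norm_pt ?zigzag_ge0//; exact: zigzag_inv_le.
move=> x1 z1; have xz := zero _ x1; have zz := zero _ z1.
have [x0|[e [y [y0 xE]]]] := pt_cover x1.
  by move: zz; rewrite x0 swap_fun0 !sub0r !normrN; have := normr_ge0 z; lra.
have [z0|[e' [u [u0 zE]]]] := pt_cover z1.
  by move: xz; rewrite z0 swap_fun0 !subr0; have := normr_ge0 x; lra.
have [ee'|ee'] := eqVneq e e'; last first.
  have e'E : e' = ~~ e by case: e e' ee' {xE zE} => -[].
  apply: (le_trans (ler_normB _ _)).
  have -> : `|x - z| = `|x| + `|z| by rewrite xE zE e'E pt_distN// !norm_pt.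
  by have := normr_ge0 x; have := normr_ge0 z; lra.
subst e'; rewrite xE zE !swap_fun_pt// !pt_dist ?zigzag_ge0//.
have lip : `|zigzag y - zigzag u| <= 6 * `|y - u|.
  have [yu|uy] := leP y u.
    by have := @zigzag_lip R y u; rewrite y0 yu (distrC y u)
      (@ger0_norm _ (u - y)) ?subr_ge0// => ->.
  have := @zigzag_lip R u y; rewrite u0 (ltW uy) distrC (@gtr0_norm _ (y - u)) ?subr_gt0//.
  by move=> ->.
have -> : 96 * (`|y - u| / ((1 + y) * (1 + u))) = (6 * `|y - u|) * ((4 / (1 + y)) * (4 / (1 + u))).
  by field; rewrite !gt_eqF ?pt_gt0.
have k0 v : 0 <= v -> 0 <= (1 + zigzag v)^-1.
  by move=> v0; rewrite invr_ge0 ltW// pt_gt0// zigzag_ge0.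
rewrite invfM; apply: ler_pM => //; first by rewrite mulr_ge0 ?k0.
by apply: ler_pM; rewrite ?k0 ?zigzag_inv_le.
Qed.

Definition swap_map (x : \bar R) : \bar R := (swap_fun (fine x))%:E.

Definition swap_part : set (\bar R) := [set 0%E] `|` [set x | exists e n, x = (pt e n%:R)%:E].

Definition cell e n : set (\bar R) :=
  [set x | exists2 y, n%:R < y < n.+1%:R & x = (pt e y)%:E].

Local Notation a := (-1)%:E.
Local Notation b := 1%:E.

Lemma swap_dom (x : \bar R) : x \in `[a, b] <-> exists2 r : R, x = r%:E & -1 <= r <= 1.
Proof.
split; last by move=> [r -> r1]; rewrite in_itv/= !lee_fin.
rewrite in_itv/=; case: x => [r||] //; last by move=> /andP[].
by rewrite !lee_fin => r1; exists r.
Qed.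

Lemma swap_map_fun : set_fun `[a, b] `[a, b] swap_map.
Proof.
move=> x /swap_dom[r -> r1]; apply/swap_dom; exists (swap_fun r) => //.
exact: swap_fun_range.
Qed.

Lemma swap_map_continuous : {within `[a, b], continuous swap_map}.
Proof.
apply/subspace_continuousP => x /swap_dom[r -> r1] W.
rewrite /swap_map /= => nW.
have [d /= d0 dW] : exists2 d : R, 0 < d & forall t, `|swap_fun r - t| < d -> W t%:E.
  have /nbhs_ballP[d d0 dW] : nbhs (swap_fun r) [set t : R | W t%:E] := nW.
  by exists d => // t rt; exact: dW.
have : nbhs r [set t : R | -1 <= t <= 1 -> W (swap_fun t)%:E].
  apply/nbhs_ballP; exists (d / 96); first by rewrite /= divr_gt0.
  move=> t /=; rewrite /ball /= => rt t1; apply: dW.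
  by apply: (le_lt_trans (swap_fun_lip r1 t1)); rewrite mulrC -ltr_pdivlMr.
move=> h; rewrite /nbhs /= /within /=.
apply: (@filterS _ (nbhs r) _ _ _ _ h) => t /= th tab.
by apply: th; move/swap_dom: tab => [s [->]].
Qed.

Lemma pt_ltE y z : 0 <= y -> 0 <= z -> (pt false y < pt false z) = (z < y).
Proof.
by move=> y0 z0; rewrite /pt expr0 !mul1r ltf_pV2 ?posrE ?pt_gt0// ltrD2l.
Qed.

Lemma pt_true y : pt true y = - pt false y. Proof. by rewrite -(ptN false). Qed.

Lemma pt_false_gt0 y : 0 <= y -> 0 < pt false y.
Proof. by move=> y0; rewrite /pt expr0 mul1r invr_gt0 pt_gt0. Qed.

Lemma nat_not_between n m : ~ (n%:R < (m%:R : R) < n.+1%:R).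
Proof. by rewrite !ltr_nat; lia. Qed.

Lemma swap_part_pt e n : swap_part (pt e n%:R)%:E.
Proof. by right; exists e, n. Qed.

Lemma cell_swap_part e n x : cell e n x%:E -> ~ swap_part x%:E.
Proof.
move=> [y /andP[ny yn] [->]]; have y0 : 0 <= y by apply: le_trans (ltW ny).
case=> [/= -[]|[e' [m [/pt_inj]]]]; first by apply/eqP; exact: pt_neq0.
by move=> /(_ y0 (ler0n _ _))[_ ym]; apply: (@nat_not_between n m); rewrite -ym ny.
Qed.

(** [pt] preserves the order on the negative copy and reverses it on the positive one, so the two
    endpoints swap roles. *)
Lemma cell_gap e n : exists p q : \bar R, gap swap_part p q /\ cell e n = `]p, q[%classic.
Proof.
have n0 : 0 <= n%:R :> R by []; have n1 : 0 <= n.+1%:R :> R by [].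
have lt10 : pt false n.+1%:R < pt false n%:R by rewrite pt_ltE// ltr_nat.
have [p [q [pP qP pq cE]]] : exists p q, [/\ swap_part p%:E, swap_part q%:E, p < q &
    cell e n = `]p%:E, q%:E[%classic].
  case: e.
    exists (pt true n%:R), (pt true n.+1%:R); split; do ?exact: swap_part_pt.
      by rewrite !pt_true ltrN2.
    apply/seteqP; split=> x.
      move=> [y /andP[ny yn] ->]; rewrite /= in_itv/= !lte_fin !pt_true !ltrN2.
      by have y0 := le_trans n0 (ltW ny); rewrite !pt_ltE// ny.
    rewrite /= in_itv/=; case: x => [x||]; last 2 first.
    - by move=> /andP[].
    - by move=> /andP[].
    rewrite !lte_fin => /andP[h1 h2]; have x1 : -1 <= x <= 1.
      have /andP[l1 _] := pt_range true n0; have := pt_false_gt0 n1.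
      by move: h2; rewrite pt_true => *; apply/andP; split; lra.
    have [x0|[e' [y [y0 xE]]]] := pt_cover x1.
      by exfalso; have := pt_false_gt0 n1; move: h2; rewrite pt_true x0; lra.
    move: h1 h2; rewrite xE; case: e' {xE}; last first.
      by have := pt_false_gt0 y0; have := pt_false_gt0 n1; rewrite !pt_true => *; exfalso; lra.
    by rewrite !pt_true !ltrN2 !pt_ltE// => h1 h2; exists y; rewrite ?h1 ?h2 ?pt_true.
  exists (pt false n.+1%:R), (pt false n%:R); split;
    [exact: swap_part_pt|exact: swap_part_pt|exact: lt10|].
  apply/seteqP; split=> x.
    move=> [y /andP[ny yn] ->]; rewrite /= in_itv/= !lte_fin.
    by have y0 := le_trans n0 (ltW ny); rewrite !pt_ltE// ny yn.
  rewrite /= in_itv/=; case: x => [x||]; last 2 first.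
  - by move=> /andP[].
  - by move=> /andP[].
  rewrite !lte_fin => /andP[h1 h2]; have x1 : -1 <= x <= 1.
    have /andP[_ l1] := pt_range false n0; have := pt_false_gt0 n1.
    by move=> *; apply/andP; split; lra.
  have [x0|[e' [y [y0 xE]]]] := pt_cover x1.
    by exfalso; have := pt_false_gt0 n1; move: h1; rewrite x0; lra.
  move: h1 h2; rewrite xE; case: e' {xE}.
    by have := pt_false_gt0 y0; have := pt_false_gt0 n1; rewrite !pt_true => *; exfalso; lra.
  by rewrite !pt_ltE// => h1 h2; exists y; rewrite ?h1 ?h2.
exists p%:E, q%:E; split=> //; split=> //.
move=> z zpq zP; have : cell e n z by rewrite cE /= in_itv.
by case=> y ny zE; apply: (@cell_swap_part e n (pt e y)); rewrite -?zE//; exists y.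
Qed.

Lemma swap_part_sub : swap_part `<=` `[a, b].
Proof.
move=> x [->|[e [n ->]]]; apply/swap_dom; first by exists 0 => //; rewrite lerN10 ler01.
by exists (pt e n%:R) => //; exact: pt_range.
Qed.

Lemma cell_cover (x : \bar R) : x \in `[a, b] -> ~ swap_part x -> exists e n, cell e n x.
Proof.
move=> /swap_dom[r -> r1] nP; have [r0|[e [y [y0 rE]]]] := pt_cover r1.
  by exfalso; apply: nP; left; rewrite r0.
have [n /andP[ny yn]] := in_unit y0; exists e, n; exists y; last by rewrite rE.
rewrite yn andbT lt_neqAle ny andbT; apply/eqP => nyE.
by apply: nP; rewrite rE -nyE; exact: swap_part_pt.
Qed.

(** A point off [swap_part] lies either outside [-1, 1] or in a cell, and cells are open gaps. *)
Lemma swap_part_closed : closed swap_part.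
Proof.
rewrite -openC openE => z nPz; rewrite /interior.
have [zab|nzab] := boolP (z \in `[a, b]).
  have [e [n cz]] := cell_cover zab nPz; have [p [q [[_ _ _ nP] cE]]] := cell_gap e n.
  apply: (@filterS _ (nbhs z) _ `]p, q[%classic).
    by move=> w; rewrite /= in_itv/= => pwq; exact: nP.
  by apply: open_nbhs_nbhs; split; [exact: itv_open|rewrite -cE].
apply: (@filterS _ (nbhs z) _ (~` `[a, b]%classic)).
  by move=> w nw Pw; apply: nw; exact: swap_part_sub.
apply: open_nbhs_nbhs; split; last by move=> /= h; move: nzab; rewrite h.
by rewrite openC; exact: itv_closed.
Qed.

Lemma basic_cell I : basic_intervals a b swap_part I <-> exists e n, I = cell e n.
Proof.
have Pa : swap_part a by rewrite (_ : a = (pt true 0%:R)%:E)//; [exact: swap_part_pt|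
  by rewrite pt_true /pt expr0 mul1r addr0 invr1].
have Pb : swap_part b by rewrite (_ : b = (pt false 0%:R)%:E)//; [exact: swap_part_pt|
  by rewrite /pt expr0 mul1r addr0 invr1].
split=> [|[e [n ->]]]; last first.
  apply/(basic_intervalsP _ swap_part_closed swap_part_sub Pa Pb).
  by have [p [q [gpq cE]]] := cell_gap e n; exists p, q.
move=> [x [xab nPx] ->]; have [e [n cx]] := cell_cover xab nPx.
exists e, n; have [p [q [gpq cE]]] := cell_gap e n; rewrite cE.
by apply: (gap_component swap_part_sub gpq); move: cx; rewrite cE /= in_itv.
Qed.

Lemma swap_map_pt e y : 0 <= y -> swap_map (pt e y)%:E = (pt (~~ e) (zigzag y))%:E.
Proof. by move=> y0; rewrite /swap_map /= swap_fun_pt. Qed.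

Lemma zigzag_monotone n :
  (forall y z, n%:R <= y -> y <= z -> z <= n.+1%:R -> zigzag y <= zigzag z) \/
  (forall y z, n%:R <= y -> y <= z -> z <= n.+1%:R -> zigzag z <= zigzag y).
Proof.
have [A0|A0] := leP 0 ((vtx n.+1)%:R - (vtx n)%:R : R); [left|right] => y z ny yz zn;
  rewrite !(@zigzagE _ n) ?ny ?zn ?(le_trans ny yz) ?(le_trans yz zn)// lerD2l.
  by rewrite ler_wpM2r// lerB.
by rewrite ler_wnM2r ?(ltW A0)// lerB.
Qed.

Lemma pt_leE e y z : 0 <= y -> 0 <= z ->
  (pt e y <= pt e z) = if e then y <= z else z <= y.
Proof.
move=> y0 z0; have h u v : 0 <= u -> 0 <= v -> (pt false u <= pt false v) = (v <= u).
  by move=> u0 v0; rewrite leNgt pt_ltE// -leNgt.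
by case: e; rewrite ?pt_true ?lerN2 h.
Qed.

Lemma cpmm_swap_map : cpmm a b swap_map swap_part.
Proof.
split.
- by rewrite lte_fin; lra.
- exact: swap_map_fun.
- exact: swap_map_continuous.
- exact: swap_part_sub.
- exact: swap_part_closed.
- pose F (o : option (bool * nat)) : \bar R := if o is Some (e, n) then (pt e n%:R)%:E else 0%E.
  have cF : countable (F @` setT).
    by apply: (card_le_trans (card_image_le _ _)); exact: countableP.
  apply: sub_countable cF; apply: subset_card_le => x [->|[e [n ->]]]; first by exists None.
  by exists (Some (e, n)).
- by rewrite (_ : a = (pt true 0%:R)%:E)//; [exact: swap_part_pt|
    rewrite pt_true /pt expr0 mul1r addr0 invr1].
- by rewrite (_ : b = (pt false 0%:R)%:E)//; [exact: swap_part_pt|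
    rewrite /pt expr0 mul1r addr0 invr1].
- move=> _ [x [->|[e [n ->]]] <-]; first by left; rewrite /swap_map /= /swap_fun eqxx.
  rewrite swap_map_pt// (@zigzagE _ n) ?lexx ?ler_nat ?leqnSn// subrr mul0r addr0.
  exact: swap_part_pt.
- move=> I /basic_cell[e [n ->]].
  have anti (x x' : \bar R) : cell e n x -> cell e n x' -> (x <= x')%E ->
      exists y z, [/\ n%:R <= y, y <= z, z <= n.+1%:R &
        (swap_map x = (pt (~~ e) (zigzag (if e then y else z)))%:E) /\
        (swap_map x' = (pt (~~ e) (zigzag (if e then z else y)))%:E)].
    move=> [y /andP[ny yn] ->] [z /andP[nz zn] ->]; rewrite lee_fin.
    have y0 : 0 <= y by rewrite (le_trans _ (ltW ny)).
    have z0 : 0 <= z by rewrite (le_trans _ (ltW nz)).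
    rewrite pt_leE//; case: e => yz; [exists y, z|exists z, y]; rewrite !swap_map_pt//;
      by split=> //; exact: ltW.
  have g0 y : n%:R <= y -> 0 <= zigzag y by move=> ny; apply: zigzag_ge0; apply: le_trans ny.
  (* Exchanging the copies reverses orientation: where [zigzag] increases, [swap_map] decreases. *)
  have [mono|mono] := zigzag_monotone n; [right|left] => x x' cx cx' xx';
    have [y [z [ny yz zn [-> ->]]]] := anti _ _ cx cx' xx'; have := mono y z ny yz zn;
    rewrite lee_fin pt_leE; try (by case: (e); apply: g0 => //; apply: le_trans yz);
    by case: (e).
Qed.


(** * Coverings of unit intervals and transitivity *)

Definition covers n m k : Prop := forall z, m%:R < z < m.+1%:R ->
  exists2 y, n%:R < y < n.+1%:R & iter k zigzag y = z.

Lemma covers_trans n m l j k : covers n m j -> covers m l k -> covers n l (k + j).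
Proof.
move=> nm ml z /ml[w /nm[y ny <-] <-]; exists y => //; exact: iterD.
Qed.

Lemma covers0 n : covers n n 0. Proof. by move=> z nz; exists z. Qed.

Lemma covers1 n m : (vlo n <= m < vhi n)%N -> covers n m 1.
Proof.
move=> /andP[lm mh] z /andP[mz zm].
have [|y ny yz] := @zigzag_onto R n z; last by exists y.
by rewrite (le_lt_trans _ mz) ?ler_nat// (lt_le_trans zm) ?ler_nat.
Qed.

(** The unit intervals with even left endpoint serve as stepping stones: each of them reaches the
    even one two below, and an odd one reaches the even one just below it. *)
Lemma covers_to0 n : exists k, covers n 0 k.
Proof.
have even i : exists k, covers i.*2 0 k.
  elim: i => [|i [k IH]]; first by exists 0%N; exact: covers0.
  exists (k + 1)%N; apply: covers_trans IH; apply: covers1.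
  by rewrite vlo_double vhi_double; lia.
rewrite -(odd_double_half n); case: (odd n); rewrite ?add0n ?add1n //.
have [k ck] := even n./2; exists (k + 1)%N; apply: covers_trans ck; apply: covers1.
by rewrite vlo_doubleS vhi_doubleS; lia.
Qed.

Lemma covers_from0 n : exists k, covers 0 n k.
Proof.
have even i : exists k, covers 0 i.*2 k.
  elim: i => [|i [k IH]]; first by exists 0%N; exact: covers0.
  exists (1 + k)%N; apply: covers_trans IH _; apply: covers1.
  by rewrite vlo_double vhi_double; lia.
rewrite -(odd_double_half n); case: (odd n); rewrite ?add0n ?add1n //.
have [k ck] := even n./2; exists (1 + k)%N; apply: covers_trans ck _; apply: covers1.
by rewrite vlo_double vhi_double; lia.
Qed.

(** Each step exchanges the copies, so the parity of a path decides where it ends. The first unit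
    interval covers itself in one step, and a path through it can be lengthened by one. *)
Lemma covers_parity n m e : exists k, odd k = e /\ covers n m k.
Proof.
have [k nk] := covers_to0 n; have [j mj] := covers_from0 m.
have loop : covers 0 0 1 by exact: covers1.
have [ke|ke] := eqVneq (odd (j + k)) e.
  by exists (j + k)%N; split=> //; exact: covers_trans mj.
exists (j + (1 + k))%N; split; last first.
  by apply: covers_trans mj; exact: covers_trans loop.
by move: ke; rewrite add1n addnS /=; case: (odd _) e => -[].
Qed.

(** [N] bounds the number of doublings to length 2, at which the interval contains a unit interval
    between integers. Before that, at most one integer has to be cut at; the longer piece keeps half
    of the length and is stretched by at least 4. *)
Lemma expansion p q : 0 <= p -> p < q -> exists n k,
  forall z, n%:R < z < n.+1%:R -> exists2 y, p < y < q & iter k zigzag y = z.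
Proof.
move=> p0 pq; have [N pqN] : exists N, 2 <= 2 ^+ N * (q - p).
  have qp : 0 < q - p by rewrite subr_gt0.
  exists (Num.truncn (2 / (q - p))).+1; rewrite -ler_pdivrMr//.
  have h : 2 / (q - p) < (Num.truncn (2 / (q - p))).+1%:R by exact: truncnS_gt.
  by rewrite (le_trans (ltW h))// -natrX ler_nat ltnW// ltn_expl.
elim: N p q p0 pq pqN => [|N IH] p q p0 pq pqN.
  have [n /andP[np pn]] := in_unit p0; exists n.+1, 0%N => z /andP[nz zn]; exists z => //.
  rewrite (lt_trans pn nz) (lt_le_trans zn)//.
  have e : n.+2%:R = n%:R + 2 :> R by rewrite -natrD addn2.
  by rewrite expr0 mul1r in pqN; rewrite e; lra.
have [n /andP[np pn]] := in_unit p0.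
have step p' q' : p <= p' -> q' <= q -> n%:R <= p' ->
    forall m, m%:R <= p' -> p' < q' -> q' <= m.+1%:R ->
    (q - p) <= 2 * (q' - p') -> exists n k,
    forall z, n%:R < z < n.+1%:R -> exists2 y, p < y < q & iter k zigzag y = z.
  move=> pp' qq' np' m mp' p'q' q'm len.
  have [u [v [u0 uv onto]]] := zigzag_stretch mp' p'q' q'm.
  have e0 : 0 <= (2 : R) ^+ N by rewrite exprn_ge0.
  have [||i [k ik]] := IH u v u0; first by lra.
    move: pqN; rewrite exprS => h; nra.
  exists i, k.+1 => z /ik[w /onto[y /andP[py yq] yw] <-]; exists y.
    by rewrite (le_lt_trans pp' py) (lt_le_trans yq).
  by rewrite iterSr yw.
have [qn|nq] := leP q n.+1%:R.
  by apply: (step p q _ _ np n) => //; lra.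
have [nq'|qn'] := leP n.+2%:R q.
  exists n.+1, 0%N => z /andP[nz zn]; exists z => //.
  by rewrite (lt_trans pn nz) (lt_le_trans zn).
have [h|h] := leP (q - p) (2 * (n.+1%:R - p)).
  by apply: (step p n.+1%:R _ _ np n) => //; exact: ltW.
apply: (step n.+1%:R q _ _ _ n.+1) => //; rewrite ?ltW ?ltr_nat//; lra.
Qed.

Lemma iter_zigzag_ge0 k y : 0 <= y -> 0 <= iter k zigzag y.
Proof. by move=> y0; elim: k => //= k; exact: zigzag_ge0. Qed.

Lemma iter_swap_map_pt k e y : 0 <= y ->
  iter k swap_map (pt e y)%:E = (pt (e (+) odd k) (iter k zigzag y))%:E.
Proof.
move=> y0; elim: k => [|k IH]; first by rewrite /= addbF.
by rewrite !iterS IH swap_map_pt ?iter_zigzag_ge0// addbN.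
Qed.

Lemma open_pt (U : set (\bar R)) : open U -> U `&` `[a, b] !=set0 ->
  exists e p q, [/\ 0 <= p, p < q & forall y, p < y < q -> U (pt e y)%:E].
Proof.
move=> oU [x [Ux /swap_dom[r xr r1]]]; rewrite xr in Ux.
have : nbhs r%:E U by apply: open_nbhs_nbhs.
move=> nU; have /nbhs_ballP[d /= d0 dU] : nbhs r [set t : R | U t%:E] := nU.
have [r0|[e [y [y0 rE]]]] := pt_cover r1.
  (* A neighbourhood of 0 reaches both copies, and the negative one is chosen; [y > d^-1] puts
     [pt e y] within [d] of 0. *)
  exists true, d^-1, (d^-1 + 1); split; [by rewrite invr_ge0 ltW|by rewrite ltrDl|].
  move=> y /andP[dy _]; have y0 : 0 <= y by rewrite (le_trans _ (ltW dy))// invr_ge0 ltW.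
  apply: dU; rewrite /ball /= r0 sub0r normrN norm_pt// invf_plt ?posrE ?pt_gt0//; lra.
exists e, y, (y + d); split=> //; first by rewrite ltrDl.
move=> z /andP[yz zd]; have z0 : 0 <= z by rewrite (le_trans y0)// ltW.
apply: dU; rewrite /ball /= rE pt_dist// distrC gtr0_norm ?subr_gt0//.
rewrite ltr_pdivrMr ?mulr_gt0 ?pt_gt0//.
have yz0 : 0 <= y * z by exact: mulr_ge0.
have : d <= d * ((1 + y) * (1 + z)) by rewrite ler_peMr ?(ltW d0)//; lra.
by move=> ?; lra.
Qed.

Lemma swap_map_transitive : topologically_transitive a b swap_map.
Proof.
move=> U V oU oV U0 V0.
have [e [p [q [p0 pq Upq]]]] := open_pt oU U0.
have [e' [p' [q' [p'0 pq' Vpq]]]] := open_pt oV V0.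
have [m /andP[mp pm]] := in_unit p'0.
have [z /andP[pz zmin]] : exists z, p' < z < Num.min q' m.+1%:R.
  have h : p' < Num.min q' m.+1%:R by rewrite lt_min pq' pm.
  by exists ((p' + Num.min q' m.+1%:R) / 2); apply/andP; split; lra.
move: zmin; rewrite lt_min => /andP[zq zm].
have [n [k nk]] := expansion p0 pq.
(* The parity of [j] is prescribed so that [j + k] exchanges lead from copy [e] to copy [e']. *)
have [j [jodd nm]] := covers_parity n m (e (+) odd k (+) e').
have [|w nw wz] := nm z; first by rewrite zm (le_lt_trans mp).
have [y /andP[py yq] yw] := nk _ nw.
have y0 : 0 <= y by rewrite (le_trans p0)// ltW.
have yab : (pt e y)%:E \in `[a, b] by apply/swap_dom; exists (pt e y) => //; exact: pt_range.
exists (j + k)%N, (pt e' z)%:E; split.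
  exists (pt e y)%:E; first by split=> //; apply: Upq; rewrite py.
  rewrite iter_swap_map_pt// iterD yw wz oddD jodd; congr ((pt _ _)%:E).
  by case: (e) (e') (odd k) => -[] [].
split; first by apply: Vpq; rewrite pz.
by apply/swap_dom; exists (pt e' z) => //; apply: pt_range; rewrite (le_trans p'0)// ltW.
Qed.

(** * Transition sums and eigenvectors of the example *)

Lemma cell_basic e n : basic_intervals a b swap_part (cell e n).
Proof. by apply/basic_cell; exists e, n. Qed.

Definition cellI e n : basic_intervals a b swap_part := SigSub (mem_set (cell_basic e n)).

Lemma cellI_cover (K : basic_intervals a b swap_part) : exists e n, K = cellI e n.
Proof.
have /basic_cell[e [n Ken]] := set_valP K.
by exists e, n; apply: val_inj.
Qed.

Lemma cell_mid e n : cell e n (pt e (n%:R + 2^-1))%:E.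
Proof. by exists (n%:R + 2^-1) => //; rewrite -[n.+1%:R]natr1; apply/andP; split; lra. Qed.

Lemma mid_ge0 n : 0 <= n%:R + 2^-1 :> R.
Proof. by rewrite addr_ge0. Qed.

Lemma mid_itv n i j : i%:R < (n%:R + 2^-1 : R) < j%:R -> (i <= n < j)%N.
Proof.
move=> /andP[h1 h2]; apply/andP; split.
  have [//|ni] := leqP i n; move: ni; rewrite -(ler_nat R) -[n.+1%:R]natr1 => ni.
  by exfalso; lra.
have [//|jn] := ltnP n j; move: jn; rewrite -(ler_nat R) => jn.
by exfalso; lra.
Qed.

Lemma cell_inj e n e' m : cell e n = cell e' m -> e = e' /\ n = m.
Proof.
move=> en; have := cell_mid e n; rewrite en => -[y /andP[my ym] [/pt_inj]].
have y0 : 0 <= y by rewrite (le_trans _ (ltW my)).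
move=> /(_ (mid_ge0 _) y0)[ee ny]; split=> //; move: my ym; rewrite -ny => my ym.
have /andP[mn] : (m <= n < m.+1)%N by apply: mid_itv; rewrite my.
by rewrite ltnS => nm; apply/eqP; rewrite eqn_leq mn nm.
Qed.

(** The midpoint of the target cell decides the inclusion: its sign determines the copy, and being
    half an integer it lies between [vlo n] and [vhi n] only if its whole unit interval does. *)
Lemma cell_image_sub e n e' m :
  cell e' m `<=` swap_map @` cell e n <-> e' = ~~ e /\ (vlo n <= m < vhi n)%N.
Proof.
have ge0 k y : k%:R < y -> 0 <= y by move=> ky; rewrite (le_trans _ (ltW ky)).
split=> [|[-> nm] _ [z /(covers1 nm)[y ny yz] ->]]; last first.
  exists (pt e y)%:E; first by exists y.
  by rewrite swap_map_pt -?yz//; case/andP: ny => /ge0.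
move=> /(_ _ (cell_mid e' m))[_ [y ny ->]].
have y0 : 0 <= y by case/andP: ny => /ge0.
rewrite swap_map_pt// => -[/pt_inj] /(_ (zigzag_ge0 y0) (mid_ge0 _))[<- yE]; split=> //.
by apply: mid_itv; rewrite -yE; exact: zigzag_strictly_between.
Qed.

Lemma transition_sum e n (w : basic_intervals a b swap_part -> R) : (forall K, 0 <= w K) ->
  (\esum_(K in [set: basic_intervals a b swap_part])
    (transition_matrix swap_map (cellI e n) K * w K)%:E =
   (\sum_(vlo n <= m < vhi n) w (cellI (~~ e) m))%:E)%E.
Proof.
move=> w0; pose D := [set` index_iota (vlo n) (vhi n)] : set nat.
transitivity (\esum_(K in cellI (~~ e) @` D) (w K)%:E)%E.
  rewrite [RHS]esum_mkcond; apply: eq_esum => K _; rewrite /transition_matrix.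
  have [e' [m ->]] := cellI_cover K.
  case: ifPn => [/set_mem[i Di /(congr1 set_val)/cell_inj[<- <-]]|/negP nD].
    rewrite asboolT ?mul1r//; apply/cell_image_sub; split=> //.
    by move: Di; rewrite /D /= mem_index_iota.
  rewrite asboolF ?mul0r// => /cell_image_sub[e'E nm]; apply: nD; rewrite inE.
  by exists m; rewrite ?e'E// /D /= mem_index_iota.
rewrite esum_image; last by move=> i j _ _ /(congr1 set_val)/cell_inj[].
rewrite esum_fset.
- by rewrite /D -fsbig_seq ?iota_uniq// sumEFin.
- exact: finite_seq.
- by move=> i _; rewrite lee_fin.
Qed.

Section block_sums.
Variable F : nat -> R.

(** [vlo] and [vhi] take even values, so every row of the matrix is a sum of such pairs and the
    eigenvector equations close up on them. *)
Definition block k : R := F k.*2 + F k.*2.+1.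

Lemma sum_image0 : \sum_(vlo 0 <= m < vhi 0) F m = block 0 + block 1.
Proof.
rewrite (_ : vlo 0 = 0%N)// (_ : vhi 0 = 4%N)//.
by do 4 rewrite big_ltn//; rewrite big_geq// addr0 /block !addrA.
Qed.

Lemma sum_image_double k : \sum_(vlo k.+1.*2 <= m < vhi k.+1.*2) F m =
  block k + block k.+1 + block k.+2.
Proof.
rewrite vlo_double vhi_double doubleS !addSn subSS subSS subn0 addnC !addSn add0n.
by do 6 (rewrite big_ltn; last lia); rewrite big_geq; [rewrite addr0 /block !doubleS !addrA|lia].
Qed.

Lemma sum_image_doubleS k : \sum_(vlo k.*2.+1 <= m < vhi k.*2.+1) F m =
  block k + block k.+1.
Proof.
rewrite vlo_doubleS vhi_doubleS addnC !addSn add0n.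
by do 4 (rewrite big_ltn; last lia); rewrite big_geq; [rewrite addr0 /block !doubleS !addrA|lia].
Qed.

(* Summing the eigenvector equations over a block gives
   5 c_k = c_(k-1) + 2 c_k + 2 c_(k+1), so the increments of c are halved at each step. *)
Lemma block_nondecreasing : (forall n, 0 <= F n) ->
  (forall n, \sum_(vlo n <= m < vhi n) F m = 5 * F n) -> forall k, block 0 <= block k.
Proof.
move=> F0 FE.
have b0 : 0 <= block 0 by rewrite addr_ge0.
have e0 : 5 * F 0 = block 0 + block 1 by rewrite -FE sum_image0.
have e1 k : 5 * F k.*2.+1 = block k + block k.+1 by rewrite -FE sum_image_doubleS.
have e2 k : 5 * F k.+1.*2 = block k + block k.+1 + block k.+2 by rewrite -FE sum_image_double.
have step k : block k <= block k.+1.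
  elim: k => [|k IH].
    have e1' := e1 0; have bE : block 0 = F 0 + F 1 by [].
    by rewrite double0 in e1'; lra.
  have e1' := e1 k.+1; have e2' := e2 k.
  have bE : block k.+1 = F k.+1.*2 + F k.+1.*2.+1 by [].
  by lra.
by elim=> // k; move=> /le_trans; apply.
Qed.

End block_sums.

(** The equation at the origin gives c_1 = 3/2 c_0, whence c_k = c_0 (2 - 2^-k). With c_0 = 10 the
    block sums are 20 - 10 / 2^k, and dividing the row sums by 5 gives these two formulas with
    integer constants. *)
Definition weight n : R :=
  if odd n then 8 - 3 / 2 ^+ n./2 else 12 - 7 / 2 ^+ n./2.

Lemma inv_exp2_le1 k : 0 < ((2 : R) ^+ k)^-1 <= 1.
Proof. by rewrite invr_gt0 exprn_gt0//= invf_le1 ?exprn_gt0// exprn_ege1// ler1n. Qed.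

Lemma weight_ge0 n : 0 <= weight n.
Proof. by rewrite /weight; have /andP[] := inv_exp2_le1 n./2; case: odd; lra. Qed.

Lemma weight_double k : weight k.*2 = 12 - 7 / 2 ^+ k.
Proof. by rewrite /weight odd_double doubleK. Qed.

Lemma weight_doubleS k : weight k.*2.+1 = 8 - 3 / 2 ^+ k.
Proof. by rewrite /weight /= odd_double /= uphalf_double. Qed.

Lemma weight_sum n : \sum_(vlo n <= m < vhi n) weight m = 5 * weight n.
Proof.
have half k : (2 ^+ k.+1)^-1 = (2 ^+ k)^-1 / 2 :> R by rewrite exprSr invfM.
rewrite -(odd_double_half n); case: (odd n); rewrite ?add0n ?add1n.
  by rewrite sum_image_doubleS /block !weight_double !weight_doubleS !half; lra.
case: n./2 => [|k].
  rewrite sum_image0 /block !weight_double !weight_doubleS.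
  by rewrite !half expr0; lra.
by rewrite sum_image_double /block !weight_double !weight_doubleS !half; lra.
Qed.

Lemma swap_map_eigenvector :
  exists w : basic_intervals a b swap_part -> R, nonneg_eigenvector swap_map 5 w.
Proof.
have ex (K : basic_intervals a b swap_part) : exists n, exists e, K = cellI e n.
  by have [e [n KE]] := cellI_cover K; exists n, e.
have [nu nuP] := choice ex.
have nuE e n : nu (cellI e n) = n.
  by have [e' /(congr1 set_val)/cell_inj[_ <-]] := nuP (cellI e n).
exists (weight \o nu); split.
- exists (cellI true 0); rewrite /= nuE (weight_double 0) expr0; apply/eqP; lra.
- by move=> K; exact: weight_ge0.
- move=> K; have [e [n ->]] := cellI_cover K.
  rewrite (@transition_sum e n (weight \o nu)); last by move=> L; exact: weight_ge0.
  congr EFin; rewrite /= nuE -weight_sum.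
  by apply: eq_bigr => m _; rewrite nuE.
Qed.

Lemma cell_near0 (X : set (\bar R)) : open X -> X 0%E ->
  exists k, forall e n, (k <= n)%N -> cell e n `<=` X.
Proof.
move=> oX X0; have nX : nbhs 0%:E X by apply: open_nbhs_nbhs.
have /nbhs_ballP[d /= d0 dX] : nbhs (0 : R) [set t : R | X t%:E] := nX.
exists (Num.truncn d^-1).+1 => e n kn _ [y /andP[ny _] ->].
have y0 : 0 <= y by rewrite (le_trans _ (ltW ny)).
apply: dX; rewrite /ball /= sub0r normrN norm_pt// invf_plt ?posrE ?pt_gt0//.
have h : d^-1 < (Num.truncn d^-1).+1%:R by exact: truncnS_gt.
by move: kn; rewrite -(ler_nat R) => kn; lra.
Qed.

Lemma swap_map_not_conjugate : ~ exists (c d : \bar R) (g psi : \bar R -> \bar R),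
  cpmm_constant_slope c d g 5 /\ conjugate_via a b swap_map c d g psi.
Proof.
move=> [c [d [g [psi [[Q gQ sg] [[phi [[psi_fun phi_fun] psiK phiK cpsi cphi] fg]]]]]]].
have l1 : 1 < 5 :> R by lra.
have [w [[_ _ wE] w0 wsmall]] := conjugacy_eigenvector cpmm_swap_map gQ sg l1 psi_fun phi_fun
  psiK phiK cpsi cphi fg swap_map_transitive.
have wge0 K : 0 <= w K by exact: ltW.
(* Adding the two copies cancels their exchange and leaves the equations of a single zigzag. *)
pose F n : R := w (cellI true n) + w (cellI false n).
have FE n : \sum_(vlo n <= m < vhi n) F m = 5 * F n.
  have eqn e : 5 * w (cellI e n) = \sum_(vlo n <= m < vhi n) w (cellI (~~ e) m).
    by apply: EFin_inj; rewrite -transition_sum// wE.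
  by rewrite /F big_split/= mulrDr (eqn true) (eqn false) addrC.
have F0 n : 0 < F n by rewrite addr_gt0.
have mono := block_nondecreasing (fun n => ltW (F0 n)) FE.
have b0 : 0 < block F 0 by rewrite addr_gt0.
(* A block consists of four cells, two in each copy; with weights at most an eighth of [block F 0],
   a block near 0 weighs at most half of [block F 0], against [mono]. *)
have [||X [oX X0] Xw] := wsmall 0%E _ (block F 0 / 8); first by rewrite !lte_fin; lra.
  by lra.
have [k kX] := cell_near0 oX X0.
have small e n : (k <= n)%N -> w (cellI e n) <= block F 0 / 8.
  by move=> kn; apply: Xw; exact: kX.
have k1 : (k <= k.*2)%N by lia.
have k2 : (k <= k.*2.+1)%N by lia.
have := mono k; rewrite {2}/block /F.
have := small true _ k1; have := small false _ k1.
by have := small true _ k2; have := small false _ k2; lra.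
Qed.

End example.

Theorem theorem3p3 (R : realType) :
  (forall (a b : \bar R) (f : \bar R -> \bar R) (P : set (\bar R)) (lambda : R),
    cpmm a b f P -> topologically_transitive a b f -> 1 < lambda ->
    (exists (c d : \bar R) (g psi : \bar R -> \bar R),
      cpmm_constant_slope c d g lambda /\ conjugate_via a b f c d g psi) ->
    exists v : basic_intervals a b P -> R, nonneg_eigenvector f lambda v) /\
  (exists (a b : \bar R) (f : \bar R -> \bar R) (P : set (\bar R)) (lambda : R),
    [/\ cpmm a b f P, topologically_transitive a b f, 1 < lambda,
        exists v : basic_intervals a b P -> R, nonneg_eigenvector f lambda v
      & ~ (exists (c d : \bar R) (g psi : \bar R -> \bar R),
            cpmm_constant_slope c d g lambda /\
            conjugate_via a b f c d g psi)]).
Proof.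
split.
  move=> a b f P lambda fP ftrans l1.
  move=> [c [d [g [psi [[Q gQ sg] [[phi [[psi_fun phi_fun] psiK phiK cpsi cphi] fg]]]]]]].
  have [v [vP _ _]] := conjugacy_eigenvector fP gQ sg l1 psi_fun phi_fun
    psiK phiK cpsi cphi fg ftrans.
  by exists v.
exists (-1)%:E, 1%:E, swap_map, swap_part, 5; split.
- exact: cpmm_swap_map.
- exact: swap_map_transitive.
- by lra.
- exact: swap_map_eigenvector.
- exact: swap_map_not_conjugate.
Qed.
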